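(* For $m\ge0$ and $u\in\ell(V^{(m)}_m)$, define $$\mathcal{Q}^{(m)}(u)=\mathcal{E}^{(m)}_m(u)+\frac56\Big(\frac35\Big)^m(u(p_1^{(m)})-u(p_2^{(m)}))^2.$$ Then $\mathcal{L}=\{(V_m^{(m)},\mathcal{Q}^{(m)})\}_{m\ge0}$ is a compatible sequence of resistance forms on finite sets. Moreover, let $(\mathcal{E}^{(\infty)},\mathcal{F}^{(\infty)})$ be the limit of $\mathcal{L}$, a resistance form on $V^{(\infty)}=\bigcup_{m\ge0}V_m^{(m)}$, and let $R^{(\infty)}$ be the associated resistance metric. Let $\alpha=\frac{\log5-\log3}{\log2}$ and let $c_1,c_2>0$ be constants such that the resistance metric $R$ of the standard resistance form on the Sierpinski gasket $K$ satisfies $c_1|x-y|^\alpha\le R(x,y)\le c_2|x-y|^\alpha$ for any $x,y\in K$. Then, with the same constants, $$c_1|x-y|^\alpha\le R^{(\infty)}(x,y)\le c_2|x-y|^\alpha\quad\text{for any }x,y\in V^{(\infty)}.$$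
   Context: Resistance forms. For a set $A$, $\ell(A)=\{f:A\to\mathbb{R}\}$. For a quadratic (symmetric bilinear) form write $\mathcal{Q}(u)=\mathcal{Q}(u,u)$. A resistance form $(\mathcal{E},\mathcal{F})$ on a set $X$: (RF1) $\mathcal{F}$ is a linear subspace of $\ell(X)$ containing constants, $\mathcal{E}$ is a non-negative symmetric quadratic form on $\mathcal{F}$, and $\mathcal{E}(f)=0$ iff $f$ is constant; (RF2) $\mathcal{F}$ modulo constants with $\mathcal{E}$ is a Hilbert space; (RF3) $\mathcal{F}$ separates points; (RF4) $R_{\mathcal{E}}(x,y)=\sup\{|f(x)-f(y)|^2/\mathcal{E}(f):f\in\mathcal{F},\mathcal{E}(f)\ne0\}<\infty$; (RF5) if $f\in\mathcal{F}$ then $\overline f=\min(\max(f,0),1)\in\mathcal{F}$ and $\mathcal{E}(\overline f)\le\mathcal{E}(f)$. $R_{\mathcal{E}}$ is called the resistance metric. On a finite set $V$ one has $\mathcal{F}=\ell(V)$ and one says that $\mathcal{E}$, or $(V,\mathcal{E})$, is a resistance form. For non-empty $Y\subseteq X$ the trace is $[\mathcal{F}]_Y=\{u|_Y:u\in\mathcal{F}\}$, $[\mathcal{E}]_Y(v)=\inf\{\mathcal{E}(u):u\in\mathcal{F},u|_Y=v\}$. A sequence $\{(V_m,\mathcal{E}_m)\}_{m\ge0}$ of resistance forms on finite sets is compatible if $V_m\subseteq V_{m+1}$ and $[\mathcal{E}_{m+1}]_{V_m}=\mathcal{E}_m$ for all $m\ge0$. Its limit is the pair on $\bigcup_mV_m$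 given by $\mathcal{F}_{\mathcal{L}}=\{u\in\ell(\bigcup_mV_m):\lim_m\mathcal{E}_m(u|_{V_m})<\infty\}$, $\mathcal{E}_{\mathcal{L}}(u)=\lim_m\mathcal{E}_m(u|_{V_m})$; it is a resistance form on $\bigcup_mV_m$. Sierpinski gasket. $p_0=(0,0)$, $p_1=(1,0)$, $p_2=(\frac12,\frac{\sqrt3}2)$, $F_i(z)=\frac12(z-p_i)+p_i$; $K$ is the unique non-empty compact set with $K=F_0(K)\cup F_1(K)\cup F_2(K)$. For $w=w_1\ldots w_m\in W_m=\{0,1,2\}^m$, $F_w=F_{w_1}\circ\cdots\circ F_{w_m}$. $V_0=\{p_0,p_1,p_2\}$, $V_m=\bigcup_{w\in W_m}F_w(V_0)$, $E_m=\{(F_w(p_i),F_w(p_j)):i\ne j,w\in W_m\}$, $\mathcal{E}_m(u)=\frac12(\frac53)^m\sum_{(x,y)\in E_m}(u(x)-u(y))^2$ for $u\in\ell(V_m)$. The sequence $\{(V_m,\mathcal{E}_m)\}_{m\ge 0}$ is compatible, and the standard resistance form on $K$ is $\mathcal{F}=\{f\in C(K):\lim_m\mathcal{E}_m(f|_{V_m})<\infty\}$, $\mathcal{E}(f)=\lim_m\mathcal{E}_m(f|_{V_m})$, with resistance metric $R$. It is known that constants $c_1,c_2$ as in the claim exist. Scaled gaskets. $\rho_0^{(m)}(z)=2^mz$. For $m\ge0$, $n\ge-m$: $V_n^{(m)}=\rho_0^{(m)}(V_{m+n})$ and $\mathcal{E}^{(m)}_n(u)=(\frac35)^m\mathcal{E}_{m+n}(u\circ\rho_0^{(m)})$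 for $u\in\ell(V^{(m)}_n)$. $p_i^{(m)}=\rho_0^{(m)}(p_i)=2^mp_i$ for $i=1,2$. *)

(* Defs.v *)
From mathcomp Require Import all_boot all_order all_algebra.
From mathcomp Require Import all_classical all_reals all_analysis.

Set Implicit Arguments.
Unset Strict Implicit.
Unset Printing Implicit Defensive.

Import Order.TTheory GRing.Theory Num.Theory.
Import numFieldNormedType.Exports.

Local Open Scope classical_set_scope.
Local Open Scope ring_scope.

Definition restr (R : realType) (T : Type) (A B : set T) (u : A -> R) : B -> R :=
  sigL B ('valL_ (0 : R) u).
Arguments restr {R T A} B u.

(* [restr] is total, but it is only used for [B `<=` A], where it is the usual
   restriction of functions and the default value 0 plays no role. *)
Lemma restrE (R : realType) (T : Type) (A B : set T) (u : A -> R) (a : A) (b : B) :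
  \val a = \val b -> restr B u b = u a.
Proof.
move=> ab; rewrite -[RHS](congr1 (@^~ a) (valLK (0 : R) u)).
by rewrite /restr /sigL /=; congr ('valL_ _ u _).
Qed.

Definition clip (R : realType) (X : Type) (f : X -> R) : X -> R :=
  fun x => Num.min (Num.max (f x) 0) 1.

(* [E u] is the value E(u, u) of a symmetric bilinear form on [F]; the form is
   recovered from these values by polarization.  Values of [E] outside [F] are
   irrelevant. *)
Definition quadratic_form_on (R : realType) (X : Type)
    (F : set (X -> R)) (E : (X -> R) -> R) : Prop :=
  exists B : (X -> R) -> (X -> R) -> R,
    [/\ forall f g, F f -> F g -> B f g = B g f,
        forall (a : R) f g h, F f -> F g -> F h ->
          B (a *: f + g) h = a * B f h + B g h &
        forall f, F f -> E f = B f f].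

(* R_E(x, y) in [0, +oo].  If [X] is a singleton and [E] satisfies (RF1), the
   supremum is over the empty family. *)
Definition resistance_metric (R : realType) (X : Type)
    (F : set (X -> R)) (E : (X -> R) -> R) (x y : X) : \bar R :=
  ereal_sup [set r | exists f, [/\ F f, E f != 0 &
                                   r = (`|f x - f y| ^+ 2 / E f)%:E]].

Record resistance_form (R : realType) (X : Type)
    (F : set (X -> R)) (E : (X -> R) -> R) : Prop := ResistanceForm {
  RF1_cst : forall c : R, F (fun=> c);
  RF1_linear : forall (a : R) f g, F f -> F g -> F (a *: f + g);
  RF1_quadratic : quadratic_form_on F E;
  RF1_ge0 : forall f, F f -> 0 <= E f;
  RF1_eq0 : forall f, F f -> (E f = 0 <-> exists c, f = fun=> c);
  (* By (RF1), [E] descends to an inner product on [F] modulo constants, so that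
     (RF2) amounts to completeness, stated here on representatives. *)
  RF2 : forall u : nat -> X -> R, (forall n, F (u n)) ->
    (forall e : R, 0 < e -> exists N, forall m n, (N <= m)%N -> (N <= n)%N ->
       E (u m - u n) < e) ->
    exists2 f, F f & (fun n => E (u n - f)) @ \oo --> (0 : R);
  RF3 : forall x y : X, x <> y -> exists2 f, F f & f x <> f y;
  RF4 : forall x y : X, (resistance_metric F E x y < +oo)%E;
  RF5 : forall f, F f -> F (clip f) /\ E (clip f) <= E f
}.

Definition trace_form (R : realType) (T : Type) (A B : set T)
    (F : set (A -> R)) (E : (A -> R) -> R) (v : B -> R) : R :=
  inf [set r | exists u, [/\ F u, restr B u = v & r = E u]].
Arguments trace_form {R T A} B F E v.

(* Forms on a finite set have all functions as domain, hence [setT]. *)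
Definition compatible (R : realType) (T : Type)
    (V : nat -> set T) (E : forall m, (V m -> R) -> R) : Prop :=
  forall m, V m `<=` V m.+1 /\ trace_form (V m) setT (E m.+1) = E m.

Definition finite_resistance_forms (R : realType) (T : Type)
    (V : nat -> set T) (E : forall m, (V m -> R) -> R) : Prop :=
  forall m, finite_set (V m) /\ resistance_form setT (E m).

(* For a compatible sequence the energies are nondecreasing in m, so their limit
   is finite exactly when they converge in R. *)
Definition limit_dom (R : realType) (T : Type)
    (V : nat -> set T) (E : forall m, (V m -> R) -> R) :
    set (\bigcup_m V m -> R) :=
  [set u | cvgn (fun m => E m (restr (V m) u))].

Definition limit_form (R : realType) (T : Type)
    (V : nat -> set T) (E : forall m, (V m -> R) -> R)
    (u : \bigcup_m V m -> R) : R :=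
  limn (fun m => E m (restr (V m) u)).

Notation plane R := (R^o * R^o)%type.

(* The library norm on a product is the sup norm; it induces the same topology. *)
Definition eucl_dist (R : realType) (x y : plane R) : R :=
  Num.sqrt ((x.1 - y.1) ^+ 2 + (x.2 - y.2) ^+ 2).

Definition gasket_p (R : realType) (i : 'I_3) : plane R :=
  match val i with
  | 0%N => (0, 0)
  | 1%N => (1, 0)
  | _ => (2^-1, Num.sqrt 3 / 2)
  end.

Definition gasket_F (R : realType) (i : 'I_3) (z : plane R) : plane R :=
  2^-1 *: (z - gasket_p R i) + gasket_p R i.

Definition gasket_Fw (R : realType) (w : seq 'I_3) (z : plane R) : plane R :=
  foldr (@gasket_F R) z w.

Definition is_gasket (R : realType) (K : set (plane R)) : Prop :=
  [/\ K !=set0, compact K & K = \bigcup_(i in [set: 'I_3]) (gasket_F i @` K)].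

Definition gasket_V (R : realType) (m : nat) : set (plane R) :=
  \bigcup_(w in [set: m.-tuple 'I_3]) (gasket_Fw w @` range (@gasket_p R)).
Arguments gasket_V R m : clear implicits.

Definition gasket_edges (R : realType) (m : nat) : set (plane R * plane R) :=
  [set e | exists (w : m.-tuple 'I_3) (i j : 'I_3),
     i != j /\ e = (gasket_Fw w (gasket_p R i), gasket_Fw w (gasket_p R j))].
Arguments gasket_edges R m : clear implicits.

(* ['valL_ 0 u] extends [u] by 0 outside its domain; every point at which it is
   evaluated below lies in that domain. *)
Definition gasket_energy (R : realType) (m : nat) (u : gasket_V R m -> R) : R :=
  2^-1 * (5 / 3) ^+ m *
  \sum_(e \in gasket_edges R m) ('valL_ 0 u e.1 - 'valL_ 0 u e.2) ^+ 2.

Definition std_dom (R : realType) (K : set (plane R)) : set (K -> R) :=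
  [set f | continuous f /\
           cvgn (fun m => gasket_energy (restr (gasket_V R m) f))].

Definition std_form (R : realType) (K : set (plane R)) (f : K -> R) : R :=
  limn (fun m => gasket_energy (restr (gasket_V R m) f)).

Definition gasket_rho (R : realType) (m : nat) (z : plane R) : plane R :=
  2 ^+ m *: z.

(* Here n is an integer with [- m <= n], so that [`|m%:Z + n|] is m + n. *)
Definition scaled_V (R : realType) (m : nat) (n : int) : set (plane R) :=
  gasket_rho m @` gasket_V R `|m%:Z + n|.
Arguments scaled_V R m n : clear implicits.

Definition scaled_energy (R : realType) (m : nat) (n : int)
    (u : scaled_V R m n -> R) : R :=
  (3 / 5) ^+ m *
  gasket_energy (sigL (gasket_V R `|m%:Z + n|) ('valL_ 0 u \o gasket_rho m)).

Definition scaled_p (R : realType) (m : nat) (i : 'I_3) : plane R :=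
  gasket_rho m (gasket_p R i).

Definition seq_V (R : realType) (m : nat) : set (plane R) := scaled_V R m m%:Z.
Arguments seq_V R m : clear implicits.

Definition seq_Q (R : realType) (m : nat) (u : seq_V R m -> R) : R :=
  scaled_energy u +
  5 / 6 * (3 / 5) ^+ m *
  ('valL_ 0 u (scaled_p R m 1) - 'valL_ 0 u (scaled_p R m 2)) ^+ 2.

(* Main.v *)
Require Import Defs.
From mathcomp Require Import all_boot all_order all_algebra.
From mathcomp Require Import all_classical all_reals all_analysis.
From mathcomp Require Import ring lra.
Import Order.TTheory GRing.Theory Num.Theory.
Import numFieldNormedType.Exports.
Local Open Scope classical_set_scope.
Local Open Scope ring_scope.
Set Implicit Arguments.
Unset Strict Implicit.
Unset Printing Implicit Defensive.

(** The form [seq_Q] of index [m] is the energy of the gasket scaled by [2 ^+ m],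
    closed by a resistor between its outer corners, and the argument is a network
    reduction followed by a comparison of resistances.

    Compatibility.  The gasket of index [m.+1] consists of three cells, the first
    of which carries the gasket of index [m].  Minimizing over the values outside
    [seq_V R m] replaces the second and third cells by triangles with edges of
    conductance [(3 / 5) ^+ m]; these two triangles together with the outer
    resistor, of conductance [(3 / 5) ^+ m / 2], are equivalent to one resistor of
    conductance [5 / 6 * (3 / 5) ^+ m], the one of index [m].  The lower bound is
    [closed_energy_mono], an explicit sum of squares, and the minimizer is built
    from harmonic functions in [closed_energy_ext].

    Limit.  For a sequence of finite energies with attained traces, the energies of
    a function on the union are nondecreasing, so their limit inherits the
    algebraic axioms; completeness follows from pointwise convergence and lower
    semicontinuity ([resistance_formI], [limit_resistance_form]).

    Resistance.  A function on a vertex set of the gasket extends to a continuous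
    function on [K] with the same energy ([cellwise_harmonic_std_dom]), so that the
    assumed bounds hold for the resistance on the finite graphs.  Scaling by
    [2 ^+ m] multiplies both the resistance and [|x - y| `^ alpha] by
    [(5 / 3) ^+ m], as [2 `^ alpha = 5 / 3].  Adding a resistor decreases resistances, whence the upper
    bound.  For the lower bound, the potential between two fixed points takes its
    values in [0, 1], so that the additional resistor contributes at most
    [5 / 6 * (3 / 5) ^+ m] to its energy; as [m] grows, this tends to 0. *)

(** * Energies and resistance forms *)

Section Energies.
Variable R : realType.

(** A finite energy: a non-negative quadratic form on all functions on [X],
    invariant under adding constants, decreased by clipping and continuous for
    pointwise convergence.  Bilinearity is stated as an identity on the values of
    [E], namely additivity and homogeneity of [f |-> E (f + h) - E f - E h]; in
    this form it passes to sums, compositions and limits. *)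
Record energy (X : Type) (E : (X -> R) -> R) : Prop := Energy {
  energy_bilin : forall (a : R) f g h,
    E (a *: f + g + h) - E (a *: f + g) - E h =
    a * (E (f + h) - E f - E h) + (E (g + h) - E g - E h);
  energyZ : forall (a : R) f, E (a *: f) = a ^+ 2 * E f;
  energy_ge0 : forall f, 0 <= E f;
  energyDc : forall f (c : R), E (fun x => f x + c) = E f;
  energy_clip : forall f, E (clip f) <= E f;
  energy_cvg : forall (u : nat -> X -> R) f,
    (forall x, u n x @[n --> \oo] --> f x) -> E (u n) @[n --> \oo] --> E f
}.

Lemma clip_contract (s t : R) :
  (Num.min (Num.max s 0) 1 - Num.min (Num.max t 0) 1) ^+ 2 <= (s - t) ^+ 2.
Proof.
rewrite -[leLHS]real_normK ?num_real// -[leRHS]real_normK ?num_real//.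
rewrite lerXn2r ?nnegrE//.
have := ler_norm (s - t); have := ler_norm (t - s); rewrite (distrC t s).
move: (`|s - t|) => d h1 h2; rewrite ler_norml.
by case: (leP s 0) => s0; case: (leP t 0) => t0; (do ?case: (leP _ 1) => ?);
  apply/andP; split; lra.
Qed.

Lemma energy_edge (X : Type) (x y : X) :
  energy (fun u : X -> R => (u x - u y) ^+ 2).
Proof.
split => [a f g h|a f|f|f c|f|u f cf].
- by rewrite !fctE /GRing.scale /=; ring.
- by rewrite !fctE /GRing.scale /=; ring.
- exact: sqr_ge0.
- by congr (_ ^+ 2); ring.
- exact: clip_contract.
- rewrite expr2; under eq_fun do rewrite expr2.
  by apply: cvgM; apply: cvgB.
Qed.

Lemma energyD (X : Type) (E1 E2 : (X -> R) -> R) :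
  energy E1 -> energy E2 -> energy (fun u => E1 u + E2 u).
Proof.
move=> [b1 Z1 g1 c1 l1 v1] [b2 Z2 g2 c2 l2 v2].
split => [a f g h|a f|f|f c|f|u f cf].
- transitivity ((E1 (a *: f + g + h) - E1 (a *: f + g) - E1 h) +
    (E2 (a *: f + g + h) - E2 (a *: f + g) - E2 h)); first by ring.
  by rewrite b1 b2; ring.
- by rewrite Z1 Z2 mulrDr.
- exact: addr_ge0.
- by rewrite c1 c2.
- exact: lerD.
- by apply: cvgD; [apply: v1|apply: v2].
Qed.

Lemma energyM (X : Type) (E : (X -> R) -> R) (c : R) :
  0 <= c -> energy E -> energy (fun u => c * E u).
Proof.
move=> c0 [b1 Z1 g1 c1 l1 v1].
split => [a f g h|a f|f|f d|f|u f cf].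
- by rewrite -!mulrBr b1; ring.
- by rewrite Z1 mulrCA.
- exact: mulr_ge0.
- by rewrite c1.
- exact: ler_wpM2l.
- by apply: cvgMr; apply: v1.
Qed.

Lemma energy_comp (X Y : Type) (E : (Y -> R) -> R) (phi : Y -> X) :
  energy E -> energy (fun u => E (u \o phi)).
Proof.
move=> [b1 Z1 g1 c1 l1 v1].
split => [a f g h|a f|f|f d|f|u f cf].
- exact: b1.
- exact: Z1.
- exact: g1.
- exact: c1.
- exact: l1.
- by apply: v1 => y; apply: cf.
Qed.

Lemma energy0 (X : Type) (E : (X -> R) -> R) : energy E -> E (fun=> 0) = 0.
Proof.
move=> Ee; have := energyZ Ee 0 (fun=> 0).
by rewrite scale0r expr0n mul0r.
Qed.

Lemma energy_cst (X : Type) (E : (X -> R) -> R) (c : R) :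
  energy E -> E (fun=> c) = 0.
Proof.
move=> Ee; rewrite -(energy0 Ee) -(energyDc Ee (fun=> 0) c).
by congr E; apply/funext => x; rewrite add0r.
Qed.

End Energies.

Section ResistanceForms.
Variable R : realType.

Lemma resistance_metric_le (X : Type) (F : set (X -> R)) (E : (X -> R) -> R)
    (x y : X) (C : R) :
  (forall f, F f -> 0 <= E f) ->
  (forall f, F f -> (f x - f y) ^+ 2 <= C * E f) ->
  (resistance_metric F E x y <= C%:E)%E.
Proof.
move=> E0 EC; apply: ge_ereal_sup => _ [f [Ff Ef ->]].
rewrite lee_fin ler_pdivrMr; last by rewrite lt_neqAle eq_sym Ef E0.
by rewrite real_normK ?num_real// EC.
Qed.

Lemma resistance_metric_ge (X : Type) (F : set (X -> R)) (E : (X -> R) -> R)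
    (x y : X) (f : X -> R) :
  F f -> E f != 0 -> (((f x - f y) ^+ 2 / E f)%:E <= resistance_metric F E x y)%E.
Proof.
move=> Ff Ef; apply: ereal_sup_ubound; exists f; split => //.
by rewrite real_normK ?num_real.
Qed.

(** Axioms of a resistance form in a form that is easy to check.  Completeness
    (RF2) comes from two properties: the bound of [(f x - f y) ^+ 2] by a multiple
    of [E f] makes a Cauchy sequence, normalized at [x0], converge pointwise, and
    lower semicontinuity of [E] turns this into convergence in energy.  The same
    bound gives (RF4) and the fact that only constants have zero energy. *)
Lemma resistance_formI (X : Type) (x0 : X) (F : set (X -> R)) (E : (X -> R) -> R) :
  (forall c : R, F (fun=> c)) ->
  (forall (a : R) f g, F f -> F g -> F (a *: f + g)) ->
  (forall (a : R) f g h, F f -> F g -> F h ->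
    E (a *: f + g + h) - E (a *: f + g) - E h =
    a * (E (f + h) - E f - E h) + (E (g + h) - E g - E h)) ->
  (forall (a : R) f, F f -> E (a *: f) = a ^+ 2 * E f) ->
  (forall f, F f -> 0 <= E f) ->
  (forall f (c : R), F f -> E (fun x => f x + c) = E f) ->
  (forall f, F f -> F (clip f) /\ E (clip f) <= E f) ->
  (forall x y, exists C : R, forall f, F f -> (f x - f y) ^+ 2 <= C * E f) ->
  (forall x y, x <> y -> exists2 f, F f & f x <> f y) ->
  (forall (u : nat -> X -> R) f (e : R), (forall n, F (u n)) ->
    (forall x, u n x @[n --> \oo] --> f x) -> (forall n, E (u n) <= e) ->
    F f /\ E f <= e) ->
  resistance_form F E.
Proof.
move=> Fc Fl Eb EZ E0 EDc Ecl Eco Esep Elsc.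
have Ec (c : R) : E (fun=> c) = 0.
  have <- : (0 : R) *: (fun=> c) + (fun=> c) = (fun=> c) :> (X -> R).
    by rewrite scale0r add0r.
  have -> : (0 : R) *: (fun=> c) + (fun=> c) = (fun x : X => (fun=> 0) x + c) :> (X -> R).
    by rewrite scale0r.
  rewrite EDc//; have := EZ 0 (fun=> 0) (Fc 0).
  by rewrite scale0r expr0n mul0r.
have Fsub f g : F f -> F g -> F (f - g).
  move=> Ff Fg; have -> : f - g = (-1) *: g + f by rewrite scaleN1r addrC.
  exact: Fl.
split => //.
- exists (fun f g => 2^-1 * (E (f + g) - E f - E g)); split.
  + by move=> f g _ _; rewrite (addrC f g); ring.
  + by move=> a f g h Ff Fg Fh; rewrite Eb//; ring.
  + move=> f Ff; have -> : f + f = 2%:R *: f by rewrite scaler_nat.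
    by rewrite EZ//; field.
- move=> f Ff; split => [Ef|[c ->]]; last exact: Ec.
  exists (f x0); apply/funext => x.
  have [C /(_ f Ff)] := Eco x x0; rewrite Ef mulr0 => h.
  by apply/eqP; rewrite -subr_eq0 -sqrf_eq0 eq_le h sqr_ge0.
- move=> u Fu Cu.
  (* [w n] is the representative of [u n] modulo constants vanishing at [x0]. *)
  pose w n x := u n x - u n x0.
  have wc x : cvgn (w ^~ x).
    have [C CE] := Eco x x0.
    pose D := Num.max C 1.
    have D0 : 0 < D by rewrite lt_max ltr01 orbT.
    apply: cauchy_cvg; apply: cauchy_exP => e e0.
    have [|N NP] := Cu (e ^+ 2 / D); first by rewrite divr_gt0// exprn_gt0.
    exists (w N x); exists N => // n /= Nn.
    rewrite -ball_normE /ball_/= -(ltr_pXn2r (n := 2))// ?nnegrE ?ltW//.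
    rewrite real_normK ?num_real//.
    have -> : w N x - w n x = (u N - u n) x - (u N - u n) x0.
      by rewrite /w !fctE; ring.
    apply: (le_lt_trans (CE _ (Fsub _ _ (Fu _) (Fu _)))).
    apply: (@le_lt_trans _ _ (D * E (u N - u n))).
      by rewrite ler_wpM2r// ?E0 ?le_max ?lexx//; exact: Fsub.
    by rewrite mulrC -ltr_pdivlMr// NP.
  pose f : X -> R := fun x => limn (w ^~ x).
  have wf x : w n x @[n --> \oo] --> f x by exact: wc.
  have key (e : R) : 0 < e -> exists N, forall n, (N <= n)%N ->
      F (u n - f) /\ E (u n - f) <= e.
    move=> e0; have [N NP] := Cu _ e0; exists N => n Nn.
    pose v k := u n - w (k + N)%N.
    have vE k : v k = (fun x => (u n - u (k + N)%N) x + u (k + N)%N x0).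
      by apply/funext => x; rewrite /v /w !fctE; ring.
    apply: (Elsc v).
    + move=> k; have -> : v k = 1 *: (u n - u (k + N)%N) + (fun=> u (k + N)%N x0).
        by rewrite vE scale1r.
      by apply: Fl => //; exact: Fsub.
    + move=> x; apply: cvgB; first exact: cvg_cst.
      by have := wf x; rewrite -(cvg_shiftn N).
    + move=> k; rewrite vE EDc; last exact: Fsub.
      by apply/ltW/NP => //; rewrite leq_addl.
  exists f.
    have [N /(_ N (leqnn _))[FN _]] := key 1 ltr01.
    have -> : f = u N - (u N - f) by rewrite opprB addrC subrK.
    exact: Fsub.
  apply/cvgrPdist_le => e e0; have [N NP] := key e e0.
  exists N => // n /= /NP[Fn En].
  by rewrite sub0r normrN ger0_norm// E0.
- move=> x y; have [C CE] := Eco x y.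
  exact: le_lt_trans (resistance_metric_le E0 CE) (ltry _).
Qed.

Lemma resistance_form_energy (X : Type) (x0 : X) (E : (X -> R) -> R) :
  energy E ->
  (forall x y, exists C : R, forall f, (f x - f y) ^+ 2 <= C * E f) ->
  resistance_form setT E.
Proof.
move=> Ee co; apply: (resistance_formI x0) => //.
- by move=> a f g h _ _ _; exact: energy_bilin.
- by move=> a f _; exact: energyZ.
- by move=> f _; exact: energy_ge0.
- by move=> f c _; exact: energyDc.
- by move=> f _; split=> //; exact: energy_clip.
- by move=> x y; have [C CE] := co x y; exists C => f _.
- move=> x y xy; exists (fun z => (`[< z = x >])%:R) => //=.
  rewrite asboolT//; case: asboolP => [yx|_]; first by case: xy.
  by apply/eqP; rewrite oner_eq0.
- move=> u f e _ uf ue; split => //.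
  apply: (cvgr_to_le (energy_cvg Ee uf)).
  by apply: nearW.
Qed.

End ResistanceForms.

(** * Limits of compatible sequences *)

Section Restrictions.
Variables (R : realType) (T : Type).

Lemma eq_sigL (A : set T) (U W : T -> R) :
  (forall x, A x -> U x = W x) -> sigL A U = sigL A W.
Proof. by move=> UW; apply/funext => x; apply/UW/set_valP. Qed.

Lemma valL_sigL (A : set T) (f : T -> R) x : A x -> 'valL_ 0 (sigL A f) x = f x.
Proof.
by move=> Ax; rewrite -[LHS]/(('valL_ 0 \o sigL A) f x) sigLK patchE mem_set.
Qed.

Lemma restr_sigL_sub (A B : set T) (f : T -> R) : B `<=` A ->
  restr B (sigL A f) = sigL B f.
Proof.
move=> BA; apply/funext => x; apply: valL_sigL; apply: BA; exact: set_valP.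
Qed.

End Restrictions.

Section Limits.
Variable R : realType.

(** The parallelogram identity without its second term. *)
Lemma energy_add_le (X : Type) (E : (X -> R) -> R) (f g : X -> R) :
  energy E -> E (f + g) <= 2 * E f + 2 * E g.
Proof.
move=> Ee.
have := energy_bilin Ee (-1) g f g.
have -> : g + g = 2%:R *: g by rewrite scaler_nat.
have -> : (-1) *: g + f + g = f by rewrite scaleN1r addrAC addNr add0r.
rewrite (energyZ Ee); have := energy_ge0 Ee ((-1) *: g + f); lra.
Qed.

(** The limit of a nondecreasing sequence of energies on one set is a resistance
    form as soon as each difference of values is controlled by one of its members
    and its domain separates points. *)
Lemma limit_resistance_form (X : Type) (x0 : X) (e : nat -> (X -> R) -> R) :
  (forall m, energy (e m)) -> (forall m f, e m f <= e m.+1 f) ->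
  (forall x y, exists m, exists C : R, forall f, (f x - f y) ^+ 2 <= C * e m f) ->
  (forall x y, x <> y -> exists2 f, cvgn (e ^~ f) & f x <> f y) ->
  resistance_form [set f | cvgn (e ^~ f)] (fun f => limn (e ^~ f)).
Proof.
move=> ee emono eco esep.
have ndec f : {homo e ^~ f : n m / (n <= m)%N >-> n <= m}.
  by apply/nondecreasing_seqP => m; exact: emono.
have le_lim m f : cvgn (e ^~ f) -> e m f <= limn (e ^~ f).
  by move=> cf; apply: nondecreasing_cvgn_le.
have bnd f (M : R) : (forall m, e m f <= M) -> cvgn (e ^~ f).
  move=> fM; apply: nondecreasing_is_cvgn => //.
  by exists M => _ [m _ <-].
have elin (a : R) f g : cvgn (e ^~ f) -> cvgn (e ^~ g) -> cvgn (e ^~ (a *: f + g)).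
  move=> cf cg.
  apply: (bnd _ (2 * (a ^+ 2 * limn (e ^~ f)) + 2 * limn (e ^~ g))) => m.
  apply: (le_trans (energy_add_le _ _ (ee m))).
  rewrite (energyZ (ee m)).
  by rewrite lerD// ler_wpM2l// ?ler_wpM2l ?sqr_ge0//; exact: le_lim.
have eadd f g : cvgn (e ^~ f) -> cvgn (e ^~ g) -> cvgn (e ^~ (f + g)).
  by move=> cf cg; rewrite -(scale1r f); exact: elin.
apply: (resistance_formI x0).
- move=> c; apply: (bnd _ 0) => m.
  by rewrite (energy_cst c (ee m)).
- exact: elin.
- move=> a f g h cf cg ch.
  have cfh := eadd _ _ cf ch; have cgh := eadd _ _ cg ch.
  have cfg := elin a _ _ cf cg; have cfgh := eadd _ _ cfg ch.
  pose s m := e m (a *: f + g + h) - e m (a *: f + g) - e m h.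
  transitivity (limn s); [apply/esym/cvg_lim => //|apply/cvg_lim => //].
    by apply: cvgB => //; apply: cvgB.
  rewrite /s; under eq_fun do rewrite (energy_bilin (ee _)).
  by apply: cvgD; [apply: cvgMr|]; apply: cvgB => //; apply: cvgB.
- move=> a f cf; apply/cvg_lim => //.
  under eq_fun do rewrite (energyZ (ee _)).
  exact: cvgMr.
- by move=> f cf; apply: le_trans (le_lim 0%N f cf); exact: energy_ge0.
- move=> f c _; congr (limn _); apply/funext => m; exact: energyDc.
- move=> f cf.
  have h m : e m (clip f) <= limn (e ^~ f).
    exact: le_trans (energy_clip (ee m) f) (le_lim _ _ cf).
  have cc : cvgn (e ^~ (clip f)) by exact: bnd h.
  by split=> //; apply: limr_le => //; exact: nearW.
- move=> x y; have [m [C CE]] := eco x y; exists (Num.max C 0) => f cf.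
  apply: (le_trans (CE f)).
  apply: (@le_trans _ _ (Num.max C 0 * e m f)).
    by rewrite ler_wpM2r ?(energy_ge0 (ee m))// le_max lexx.
  by rewrite ler_wpM2l ?le_lim// le_max lexx orbT.
- exact: esep.
- move=> u f M cu uf uM.
  have h m : e m f <= M.
    apply: (cvgr_to_le (energy_cvg (ee m) uf)); apply: nearW => n.
    exact: le_trans (le_lim _ _ (cu n)) (uM n).
  have cf : cvgn (e ^~ f) by exact: bnd h.
  by split => //; apply: limr_le => //; exact: nearW.
Qed.

Section CompatibleSequence.
Variables (T : Type) (V : nat -> set T) (E : forall m, (V m -> R) -> R).
Hypothesis V0 : V 0%N !=set0.
Hypothesis Vnest : forall m, V m `<=` V m.+1.
Hypothesis Eenergy : forall m, energy (@E m).
Hypothesis Eco : forall m x y, exists C : R, forall f,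
  (f x - f y) ^+ 2 <= C * @E m f.
Hypothesis Emono : forall m (U : T -> R), E (sigL (V m) U) <= E (sigL (V m.+1) U).
Hypothesis Eext : forall m (U : T -> R), exists2 W : T -> R,
  (forall x, V m x -> W x = U x) & E (sigL (V m.+1) W) = E (sigL (V m) U).

(** Together, [Emono] and [Eext] say that the infimum that defines the trace of
    [E m.+1] on [V m] equals [E m] and is attained. *)
Lemma compatible_ext : compatible E.
Proof.
move=> m; split; first exact: Vnest.
apply/funext => v; rewrite /trace_form; set S := [set r | _].
have Sv : S (E v).
  have [W WU WE] := Eext m ('valL_ 0 v).
  exists (sigL (V m.+1) W); split => //; last by rewrite WE valLK.
  apply/funext => x; rewrite (@restrE _ _ _ _ _
    (SigSub (mem_set (@Vnest m _ (set_valP x))) : V m.+1))//=.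
  exact: etrans (WU _ (set_valP x)) (congr1 (@^~ x) (valLK (0 : R) v)).
have lbS : lbound S (E v).
  move=> _ [u [_ <- ->]]; apply: (le_trans (Emono _ _)).
  by rewrite valLK.
apply/eqP; rewrite eq_le; apply/andP; split.
  by apply: ge_inf => //; exists (E v).
by apply: lb_le_inf => //; exists (E v).
Qed.

Lemma finite_resistance_forms_ext :
  (forall m, finite_set (V m)) -> finite_resistance_forms E.
Proof.
move=> Vfin m; split => //.
have [x Vx] : V m !=set0.
  elim: m => // m [x Vx]; exists x; exact: Vnest.
exact: (resistance_form_energy (SigSub (mem_set Vx) : V m)).
Qed.

Lemma nested_subset m n : (m <= n)%N -> V m `<=` V n.
Proof.
elim: n => [|n IH]; first by rewrite leqn0 => /eqP ->.
rewrite leq_eqVlt => /predU1P[->//|]; rewrite ltnS => /IH h.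
exact: subset_trans h (@Vnest n).
Qed.


(** Energy-preserving extensions to the successive [V n], glued into one
    function. *)
Lemma harmonic_extension m (U : T -> R) : exists2 W : T -> R,
  (forall x, V m x -> W x = U x) &
  forall n, (m <= n)%N -> E (sigL (V n) W) = E (sigL (V m) U).
Proof.
have /choice[ext extP] : forall p : nat * (T -> R), exists W : T -> R,
   (forall x, V p.1 x -> W x = p.2 x) /\
   E (sigL (V p.1.+1) W) = E (sigL (V p.1) p.2).
  by move=> [k P] /=; have [W] := Eext k P; exists W.
pose Us := fix Us k := if k is k'.+1 then ext ((m + k')%N, Us k') else U.
have UsS j i x : V (m + j)%N x -> Us (j + i)%N x = Us j x.
  move=> Vx; elim: i => [|i IH]; first by rewrite addn0.
  rewrite addnS /=; have [-> //] := extP ((m + (j + i))%N, Us (j + i)%N).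
  by apply: nested_subset Vx; rewrite leq_add2l leq_addr.
(* [x] is evaluated at some stage whose vertex set contains it; all such stages
   agree. *)
pose W x := Us (xget 0%N [set k | V (m + k)%N x]) x.
have WUs j x : V (m + j)%N x -> W x = Us j x.
  move=> Vx; rewrite /W; case: xgetP => [k _ /= Vk|/(_ j)//].
  by rewrite -(UsS k j)// addnC UsS.
exists W; first by move=> x Vx; rewrite (WUs 0%N)// addn0.
move=> n /subnKC <-; rewrite (eq_sigL (WUs _)).
elim: (n - m)%N => [|k IH]; first by rewrite addn0.
rewrite addnS /=; have [_ /= ->] := extP ((m + k)%N, Us k).
exact: IH.
Qed.

Let S := \bigcup_m V m.

(** Restriction to [V m] is composition with the inclusion of [V m] into the
    union, so that [E m] becomes an energy on functions on the union. *)
Lemma restr_incl m (u : S -> R) :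
  restr (V m) u = u \o (fun x : V m =>
    SigSub (mem_set (bigcup_sup Logic.I (set_valP x) : S (\val x))) : S).
Proof. by apply/funext => x; exact: restrE. Qed.

Lemma limit_energy m : energy (fun u : S -> R => E (restr (V m) u)).
Proof.
under [X in energy X]eq_fun do rewrite restr_incl.
exact: energy_comp.
Qed.

Lemma limit_extension m (U : T -> R) : exists2 W : T -> R,
  (forall x, V m x -> W x = U x) &
  limit_dom E (sigL S W) /\ limit_form E (sigL S W) = E (sigL (V m) U).
Proof.
have [W WU WE] := harmonic_extension m U; exists W => //.
have h : E (restr (V n) (sigL S W)) @[n --> \oo] --> E (sigL (V m) U).
  apply: cvg_near_cst; exists m => // n /= mn.
  by rewrite restr_sigL_sub ?WE//; exact: bigcup_sup.
split; first by apply/cvg_ex; exists (E (sigL (V m) U)).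
exact/cvg_lim.
Qed.

Lemma limit_form_mono m (u : S -> R) : E (restr (V m) u) <= E (restr (V m.+1) u).
Proof. exact: Emono. Qed.

Lemma limit_form_ge m (u : S -> R) :
  limit_dom E u -> E (restr (V m) u) <= limit_form E u.
Proof.
move=> cu; apply: nondecreasing_cvgn_le => //.
by apply/nondecreasing_seqP => k; exact: limit_form_mono.
Qed.

Lemma limit_form_resistance_form : resistance_form (limit_dom E) (limit_form E).
Proof.
have [t Vt] := V0.
apply: (@limit_resistance_form S (SigSub (mem_set (bigcup_sup Logic.I Vt : S t)))
  (fun m u => E (restr (V m) u))).
- exact: limit_energy.
- exact: limit_form_mono.
- move=> x y.
  have [[i _ Vi] [j _ Vj]] := (set_valP x, set_valP y).
  pose m := maxn i j.
  have Vx : V m (\val x) by apply: nested_subset Vi; rewrite leq_maxl.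
  have Vy : V m (\val y) by apply: nested_subset Vj; rewrite leq_maxr.
  have [C CE] := Eco (SigSub (mem_set Vx) : V m) (SigSub (mem_set Vy)).
  exists m, C => f.
  have := CE (restr (V m) f).
  by rewrite (@restrE _ _ _ _ f x (SigSub (mem_set Vx)))//
    (@restrE _ _ _ _ f y (SigSub (mem_set Vy))).
- move=> x y xy.
  have [i _ Vi] := set_valP x; have [j _ Vj] := set_valP y.
  pose m := maxn i j.
  have Vx : V m (\val x) by apply: nested_subset Vi; rewrite leq_maxl.
  have Vy : V m (\val y) by apply: nested_subset Vj; rewrite leq_maxr.
  have [W WU [Wd _]] := limit_extension m (fun z => (`[< z = \val x >])%:R).
  exists (sigL S W) => //=.
  rewrite /sigL/= !WU// asboolT//; case: asboolP => [/val_inj yx|_].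
    by case: xy.
  by apply/eqP; rewrite oner_eq0.
Qed.

End CompatibleSequence.
End Limits.

(** * The triangle and its three cells *)

Section Triangle.
Variable R : realType.
Local Notation p := (@gasket_p R).
Local Notation F := (@gasket_F R).

Lemma ord3_ind (P : 'I_3 -> Prop) : P 0 -> P 1 -> P 2 -> forall i, P i.
Proof.
move=> P0 P1 P2 [[|[|[|//]]] h].
- by rewrite (_ : Ordinal h = 0)//; apply/val_inj.
- by rewrite (_ : Ordinal h = 1)//; apply/val_inj.
- by rewrite (_ : Ordinal h = 2)//; apply/val_inj.
Qed.

Lemma sum_ord3 (f : 'I_3 -> R) : \sum_i f i = f 0 + f 1 + f 2.
Proof.
rewrite !big_ord_recl big_ord0 addr0 addrA.
by congr (_ + f _ + f _); apply/val_inj.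
Qed.

(** Barycentric coordinates with respect to the three vertices. *)
Definition bary (i : 'I_3) (x : plane R) : R :=
  match val i with
  | 0%N => 1 - x.1 - x.2 / Num.sqrt 3
  | 1%N => x.1 - x.2 / Num.sqrt 3
  | _ => 2 * x.2 / Num.sqrt 3
  end.

(** The closed triangle spanned by the three vertices. *)
Definition triangle : set (plane R) := [set x | forall i, 0 <= bary i x].

(** The inverse of the contraction [gasket_F i]. *)
Definition gasket_G (i : 'I_3) (z : plane R) : plane R :=
  2 *: (z - p i) + p i.
Local Notation G := gasket_G.

Let s3 : Num.sqrt 3 != 0 :> R.
Proof. by rewrite gt_eqF// sqrtr_gt0. Qed.

Lemma gasket_FK i : cancel (F i) (G i).
Proof.
move=> z; rewrite /gasket_F /gasket_G addrK scalerA divff ?pnatr_eq0//.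
by rewrite scale1r subrK.
Qed.

Lemma gasket_Fp i : F i (p i) = p i.
Proof. by rewrite /gasket_F subrr scaler0 add0r. Qed.

(** The midpoint of [p i] and [p j] is the point shared by the cells [i] and
    [j]. *)
Lemma gasket_FpC i j : F i (p j) = F j (p i).
Proof.
have h : forall a b : plane R, 2^-1 *: (b - a) + a = 2^-1 *: (b + a).
  move=> a b; rewrite scalerBr scalerDr -addrA; congr (_ + _).
  by rewrite -scaleNr -[X in _ + X]scale1r -scalerDl; congr (_ *: _); field.
by rewrite /gasket_F !h addrC.
Qed.

Lemma bary_p i j : bary i (p j) = (i == j)%:R.
Proof.
by elim/ord3_ind: i; elim/ord3_ind: j; rewrite /bary /=; field.
Qed.

Lemma bary_F i j z : bary i (F j z) = (bary i z + (i == j)%:R) / 2.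
Proof.
rewrite -(bary_p i j); elim/ord3_ind: i; rewrite /bary /= /GRing.scale /=; 
  by field.
Qed.

Lemma bary_sum x : bary 0 x + bary 1 x + bary 2 x = 1.
Proof. by rewrite /bary /=; field. Qed.

Lemma bary_inj x y : (forall i, bary i x = bary i y) -> x = y.
Proof.
move=> xy; have := xy 2; have := xy 1; rewrite /bary /= => h1 h2.
have e2 : x.2 = y.2.
  have /(congr1 (fun t => t * (Num.sqrt 3 / 2))) := h2.
  have -> : 2 * x.2 / Num.sqrt 3 * (Num.sqrt 3 / 2) = x.2 by field.
  by have -> : 2 * y.2 / Num.sqrt 3 * (Num.sqrt 3 / 2) = y.2 by field.
move: h1; rewrite e2 => /addIr e1.
by rewrite (surjective_pairing x) e1 e2 -surjective_pairing.
Qed.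

Lemma gasket_p_inj : injective p.
Proof.
move=> i j ij; have := bary_p i i; rewrite ij bary_p eqxx.
by case: eqP => // _ /eqP; rewrite eq_sym oner_eq0.
Qed.

Lemma triangle_p i : triangle (p i).
Proof. by move=> j; rewrite bary_p ler0n. Qed.

Lemma triangle_F i x : triangle x -> triangle (F i x).
Proof. by move=> Tx j; rewrite bary_F divr_ge0// addr_ge0// ler0n. Qed.

Lemma triangle_corner x i : triangle x -> 1 <= bary i x -> x = p i.
Proof.
move=> Tx xi; apply: bary_inj => j; rewrite bary_p.
move: (Tx 0) (Tx 1) (Tx 2) xi; have := bary_sum x.
by elim/ord3_ind: i; elim/ord3_ind: j => /=; lra.
Qed.

(** For [x] in the triangle, an index [i] with [x] in the cell
    [gasket_F i @` triangle], if there is one; at the points shared by two cells one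
    of them is chosen.  The default value 0 is for points in no cell. *)
Definition cell (x : plane R) : 'I_3 := odflt 0 [pick i | 2^-1 <= bary i x].

Lemma cellP i y : triangle y ->
  cell (F i y) = i \/ cell (F i y) != i /\ y = p (cell (F i y)).
Proof.
move=> Ty; rewrite /cell; case: pickP => [c /=|/(_ i)]; last first.
  by move=> /negbT; rewrite -ltNge bary_F eqxx /= => ?; exfalso; have := Ty i; lra.
have [->|ci] := eqVneq c i; first by left.
rewrite bary_F (negbTE ci) /= => h; right; split => //.
by apply: triangle_corner => //; lra.
Qed.

Lemma triangle_F_meet i j x y : i != j -> triangle x -> triangle y ->
  F i x = F j y -> x = p j /\ y = p i.
Proof.
move=> ij Tx Ty e; split; apply: triangle_corner => //.
  by have := bary_F j j y; rewrite -e bary_F eqxx eq_sym (negbTE ij) /=; have := Ty j; lra.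
by have := bary_F i i x; rewrite e bary_F eqxx (negbTE ij) /=; have := Tx i; lra.
Qed.

(** The function equal to [g i \o G i] where [cell] takes the value [i]. *)
Definition glue (g : 'I_3 -> plane R -> R) (x : plane R) : R :=
  g (cell x) (G (cell x) x).

(** When the pieces agree at the points shared by two cells, the choice made by
    [cell] there is irrelevant. *)
Lemma glueE g i y : (forall i j, g i (p j) = g j (p i)) -> triangle y ->
  glue g (F i y) = g i y.
Proof.
move=> gC Ty; rewrite /glue; have [->|[_ yp]] := cellP i Ty.
  by rewrite gasket_FK.
set c := cell _ in yp *.
by rewrite yp gasket_FpC gasket_FK gC.
Qed.

End Triangle.

(** * Graph energies of the gasket *)

Section Graphs.
Variable R : realType.
Local Notation p := (@gasket_p R).
Local Notation F := (@gasket_F R).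
Local Notation V := (gasket_V R).

Lemma gasket_V0 x : V 0 x <-> exists i, x = p i.
Proof.
split=> [[w _ [_ [i _ <-] <-]]|[i ->]].
  by exists i; rewrite tuple0.
by exists [tuple] => //; exists (p i) => //; exists i.
Qed.

Lemma gasket_VS n x : V n.+1 x <-> exists i, exists2 y, V n y & x = F i y.
Proof.
split=> [[w _ [_ [i _ <-] <-]]|[i [y [w _ [_ [j _ <-] <-]] ->]]].
  case/tupleP: w => j w; exists j; exists (gasket_Fw w (p i)) => //.
  by exists w => //; exists (p i) => //; exists i.
by exists [tuple of i :: w] => //; exists (p j) => //; exists j.
Qed.

Lemma gasket_V_triangle n : V n `<=` @triangle R.
Proof.
elim: n => [|n IH] x; first by move=> /gasket_V0[i ->]; exact: triangle_p.
by move=> /gasket_VS[i [y /IH Ty ->]]; exact: triangle_F.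
Qed.

Lemma gasket_V_p n i : V n (p i).
Proof.
elim: n => [|n IH]; first by apply/gasket_V0; exists i.
by apply/gasket_VS; exists i; exists (p i) => //; rewrite gasket_Fp.
Qed.

Lemma gasket_V_nest n : V n `<=` V n.+1.
Proof.
elim: n => [|n IH] x; first by move=> /gasket_V0[i ->]; exact: gasket_V_p.
by move=> /gasket_VS[i [y /IH Vy ->]]; apply/gasket_VS; exists i; exists y.
Qed.

Lemma gasket_V_finite n : finite_set (V n).
Proof.
apply: bigcup_finite => // w _; apply: finite_image.
exact: finite_image.
Qed.

(** The image of an edge in the cell [i]. *)
Definition edge_F (i : 'I_3) (e : plane R * plane R) : plane R * plane R :=
  (F i e.1, F i e.2).

Lemma gasket_edgesS n e : gasket_edges R n.+1 e <->
  exists i, exists2 e', gasket_edges R n e' & e = edge_F i e'.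
Proof.
split=> [[w [i [j [ij ->]]]]|[k [_ [w [i [j [ij ->]]]] ->]]].
  case/tupleP: w => k w; exists k.
  by exists (gasket_Fw w (p i), gasket_Fw w (p j)) => //; exists w, i, j.
by exists [tuple of k :: w], i, j.
Qed.

Lemma gasket_edges0 : gasket_edges R 0 =
  [set` [seq (p ij.1, p ij.2) | ij <- enum [pred ij : 'I_3 * 'I_3 | ij.1 != ij.2]]].
Proof.
apply/seteqP; split=> [_ [w [i [j [ij ->]]]]|].
  rewrite tuple0/=; apply/mapP; exists (i, j) => //.
  by rewrite mem_enum.
move=> e /= /mapP[[i j]]; rewrite mem_enum => ij ->.
by exists [tuple], i, j.
Qed.

Lemma gasket_edges_triangle n e : gasket_edges R n e ->
  [/\ triangle e.1, triangle e.2 & e.1 != e.2].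
Proof.
elim: n e => [|n IH] e.
  move=> [w [i [j [ij ->]]]]; rewrite tuple0/=.
  split; [exact: triangle_p|exact: triangle_p|].
  by apply: contra ij => /eqP/gasket_p_inj->.
move=> /gasket_edgesS[i [e' /IH[T1 T2 e12] ->]]; split => /=;
  [exact: triangle_F|exact: triangle_F|].
by rewrite (can_eq (@gasket_FK R i)).
Qed.

Lemma gasket_edges_finite n : finite_set (gasket_edges R n).
Proof.
elim: n => [|n IH]; first by rewrite gasket_edges0; exact: finite_seq.
suff -> : gasket_edges R n.+1 = \bigcup_(i in [set: 'I_3]) (edge_F i @` gasket_edges R n).
  by apply: bigcup_finite => // i _; exact: finite_image.
apply/seteqP; split => e.
  by move=> /gasket_edgesS[i [e' ne ->]]; exists i => //; exists e'.
by move=> [i _ [e' ne <-]]; apply/gasket_edgesS; exists i; exists e'.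
Qed.

(** [gasket_energy] for functions on the whole plane; only their values on
    [gasket_V R n] matter. *)
Definition graph_energy (n : nat) (U : plane R -> R) : R :=
  2^-1 * (5 / 3) ^+ n *
  \sum_(e \in gasket_edges R n) (U e.1 - U e.2) ^+ 2.

Lemma gasket_energyE n (u : V n -> R) : gasket_energy u = graph_energy n ('valL_ 0 u).
Proof. by []. Qed.

(** The energy of a function on the three vertices. *)
Definition triangle_energy (a : 'I_3 -> R) : R :=
  (a 0 - a 1) ^+ 2 + (a 0 - a 2) ^+ 2 + (a 1 - a 2) ^+ 2.

Lemma graph_energy0 U : graph_energy 0 U = triangle_energy (U \o p).
Proof.
rewrite /graph_energy gasket_edges0 -fsbig_seq/=; last first.
  rewrite map_inj_uniq; last first.
    by move=> [i j] [i' j'] /= [/gasket_p_inj-> /gasket_p_inj->].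
  exact: enum_uniq.
rewrite big_map big_enum/=.
rewrite -(pair_big_dep xpredT (fun i j => i != j)
  (fun i j => (U (p i) - U (p j)) ^+ 2)) /=.
rewrite sum_ord3.
have h (i : 'I_3) : \sum_(j | i != j) (U (p i) - U (p j)) ^+ 2 =
  \sum_j (U (p i) - U (p j)) ^+ 2.
  rewrite [RHS](bigD1 i)//= subrr expr0n add0r.
  by apply: eq_bigl => j; rewrite eq_sym.
rewrite !h !sum_ord3 /triangle_energy /=; by field.
Qed.

(** Self-similarity.  The sum over the set of edges splits because an edge, having
    distinct endpoints, lies in one cell only. *)
Lemma graph_energyS n U : graph_energy n.+1 U =
  5 / 3 * \sum_i graph_energy n (U \o F i).
Proof.
rewrite /graph_energy -mulr_sumr mulrA.
have -> : 2^-1 * (5 / 3) ^+ n.+1 = 5 / 3 * (2^-1 * (5 / 3) ^+ n) :> R.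
  by rewrite exprS; ring.
congr (_ * _).
pose A i := edge_F i @` gasket_edges R n.
have Afin i : finite_set (A i) by apply/finite_image/gasket_edges_finite.
have AI i j : i != j -> A i `&` A j `<=` set0.
  move=> ij e [[d nd <-] [f nf fd]].
  have [Td1 Td2 d12] := gasket_edges_triangle nd.
  have [Tf1 Tf2 _] := gasket_edges_triangle nf.
  have [h1 _] := triangle_F_meet ij Td1 Tf1 (congr1 fst (esym fd)).
  have [h2 _] := triangle_F_meet ij Td2 Tf2 (congr1 snd (esym fd)).
  by move: d12; rewrite h1 h2 eqxx.
have -> : gasket_edges R n.+1 = A 0 `|` A 1 `|` A 2.
  apply/seteqP; split => e.
    move=> /gasket_edgesS[i [e' ne ->]].
    have : A i (edge_F i e') by exists e'.
    by elim/ord3_ind: i => ?; [left; left|left; right|right].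
  by move=> [[|]|] [e' ne <-]; apply/gasket_edgesS;
    [exists 0|exists 1|exists 2]; exists e'.
rewrite fsbigU0//; last 2 first.
- by rewrite finite_setU.
- by rewrite setIUl => e [|]; apply: AI.
rewrite fsbigU0//; last exact: AI.
have Ainj i : set_inj (gasket_edges R n) (edge_F i).
  move=> d e _ _ de; rewrite (surjective_pairing d) (surjective_pairing e).
  congr pair; apply: (can_inj (@gasket_FK R i)).
    exact: (congr1 fst de).
  exact: (congr1 snd de).
by rewrite sum_ord3 !fsbig_image.
Qed.

Lemma graph_energy_energy n : energy (graph_energy n).
Proof.
elim: n => [|n IH].
  have -> : graph_energy 0 = fun U => (U (p 0) - U (p 1)) ^+ 2 +
      (U (p 0) - U (p 2)) ^+ 2 + (U (p 1) - U (p 2)) ^+ 2.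
    by apply/funext => U; rewrite graph_energy0.
  by do 2?apply: energyD; exact: energy_edge.
have -> : graph_energy n.+1 = fun U => 5 / 3 * (graph_energy n (U \o F 0) +
    graph_energy n (U \o F 1) + graph_energy n (U \o F 2)).
  by apply/funext => U; rewrite graph_energyS sum_ord3.
apply: energyM; first by rewrite divr_ge0.
by do 2?apply: energyD; exact: energy_comp.
Qed.

Lemma eq_graph_energy n U W : (forall x, V n x -> U x = W x) ->
  graph_energy n U = graph_energy n W.
Proof.
elim: n U W => [|n IH] U W UW.
  by rewrite !graph_energy0 /triangle_energy /= !UW//; exact: gasket_V_p.
rewrite !graph_energyS; congr (_ * _); apply: eq_bigr => i _.
by apply: IH => x Vx; apply: UW; apply/gasket_VS; exists i; exists x.
Qed.

(** Differences are controlled by the energy: two points of different cells are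
    joined through the point shared by these cells. *)
Lemma graph_energy_coercive n : exists2 C : R, 0 <= C &
  forall U x y, V n x -> V n y -> (U x - U y) ^+ 2 <= C * graph_energy n U.
Proof.
elim: n => [|n [C C0 IH]].
  exists 1 => // U x y /gasket_V0[i ->] /gasket_V0[j ->].
  rewrite mul1r graph_energy0 /triangle_energy /=.
  have := sqr_ge0 (U (p 0) - U (p 1)); have := sqr_ge0 (U (p 0) - U (p 2)).
  have := sqr_ge0 (U (p 1) - U (p 2)).
  by elim/ord3_ind: i; elim/ord3_ind: j; lra.
exists (4 * C); first by rewrite mulr_ge0.
move=> U _ _ /gasket_VS[i [x Vx ->]] /gasket_VS[j [y Vy ->]].
have h k z w : V n z -> V n w ->
    (U (F k z) - U (F k w)) ^+ 2 <= C * graph_energy n.+1 U.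
  move=> Vz Vw; apply: (le_trans (IH (U \o F k) z w Vz Vw)).
  rewrite ler_wpM2l// graph_energyS sum_ord3.
  have := energy_ge0 (graph_energy_energy n) (U \o F 0).
  have := energy_ge0 (graph_energy_energy n) (U \o F 1).
  have := energy_ge0 (graph_energy_energy n) (U \o F 2).
  by elim/ord3_ind: k; lra.
have h1 := h i _ _ Vx (gasket_V_p n j).
have h2 := h j _ _ (gasket_V_p n i) Vy.
rewrite (gasket_FpC _ j i) in h2.
have := sqr_ge0 ((U (F i x) - U (F i (p j))) - (U (F i (p j)) - U (F j y))).
by lra.
Qed.

Lemma graph_energy_mono n U : graph_energy n U <= graph_energy n.+1 U.
Proof.
elim: n U => [|n IH] U; last first.
  rewrite !graph_energyS ler_wpM2l ?divr_ge0//.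
  by apply: ler_sum => i _; exact: IH.
rewrite graph_energyS sum_ord3 !graph_energy0 /triangle_energy /= !gasket_Fp.
rewrite (gasket_FpC _ 1 0) (gasket_FpC _ 2 0) (gasket_FpC _ 2 1).
move: (U (p 0)) (U (p 1)) (U (p 2)) => a b c.
move: (U (F 0 (p 1))) (U (F 0 (p 2))) (U (F 1 (p 2))) => z y x.
(* [d1], [d2], [d3] are the deviations from the harmonic values at the midpoints,
   in which the difference of the two sides is a positive quadratic form. *)
pose d1 := x - (a + 2 * b + 2 * c) / 5.
pose d2 := y - (2 * a + b + 2 * c) / 5.
pose d3 := z - (2 * a + 2 * b + c) / 5.
have := sqr_ge0 d1; have := sqr_ge0 d2; have := sqr_ge0 d3.
have := sqr_ge0 (d1 - d2); have := sqr_ge0 (d1 - d3); have := sqr_ge0 (d2 - d3).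
rewrite /d1 /d2 /d3; lra.
Qed.

Lemma graph_energy_le m n U : (m <= n)%N -> graph_energy m U <= graph_energy n U.
Proof.
have /nondecreasing_seqP h k : graph_energy k U <= graph_energy k.+1 U.
  exact: graph_energy_mono.
exact: h.
Qed.

End Graphs.

(** * Harmonic functions on the gasket *)

Section HarmonicFunctions.
Variable R : realType.
Local Notation p := (@gasket_p R).
Local Notation F := (@gasket_F R).
Local Notation G := (@gasket_G R).
Local Notation V := (gasket_V R).

(** [corner_values a i j] is the value at [gasket_F i (p j)] of the harmonic
    function with boundary values [a]: at a midpoint, two fifths of each adjacent
    boundary value plus one fifth of the opposite one. *)
Definition corner_values (a : 'I_3 -> R) (i j : 'I_3) : R :=
  if j == i then a i else (a i + a j + (a 0 + a 1 + a 2)) / 5.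

(** The values of the harmonic function with boundary values [a] at the corners of
    a cell of level [n] containing [x]; the default value of [cell] makes the
    definition total. *)
Fixpoint nested_values (n : nat) (a : 'I_3 -> R) (x : plane R) : 'I_3 -> R :=
  if n is n'.+1 then nested_values n' (corner_values a (cell x)) (G (cell x) x)
  else a.

(** The harmonic function with boundary values [a].  The ranges of the successive
    corner values around [x] are nested intervals, and [harmonic_fun a x] is the
    supremum of their lower bounds. *)
Definition harmonic_fun (a : 'I_3 -> R) (x : plane R) : R :=
  sup [set r | exists n, forall i, r <= nested_values n a x i].

Lemma corner_valuesC a i j : corner_values a i j = corner_values a j i.
Proof.
rewrite /corner_values eq_sym; case: eqP => [->//|_]; by rewrite (addrC (a i)).
Qed.

Lemma corner_values_ge a r i j : (forall i, r <= a i) -> r <= corner_values a i j.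
Proof.
move=> ra; rewrite /corner_values; case: eqP => // _.
have := ra 0; have := ra 1; have := ra 2; have := ra i; have := ra j; lra.
Qed.

Lemma corner_values_le a r i j : (forall i, a i <= r) -> corner_values a i j <= r.
Proof.
move=> ra; rewrite /corner_values; case: eqP => // _.
have := ra 0; have := ra 1; have := ra 2; have := ra i; have := ra j; lra.
Qed.

Lemma nested_values_le n a r x i :
  (forall i, a i <= r) -> nested_values n a x i <= r.
Proof.
elim: n a x => [|n IH] a x ra //=; apply: IH => j; exact: corner_values_le.
Qed.

Let bnd (a : 'I_3 -> R) : R := `|a 0| + `|a 1| + `|a 2|.

Let bnd_le a i : `|a i| <= bnd a.
Proof.
rewrite /bnd; have := normr_ge0 (a 0); have := normr_ge0 (a 1).
have := normr_ge0 (a 2); elim/ord3_ind: i; lra.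
Qed.

Lemma harmonic_fun_le a s x : (forall i, a i <= s) -> harmonic_fun a x <= s.
Proof.
move=> as_; apply: ge_sup.
  exists (- bnd a), 0%N => i /=; rewrite lerNl.
  by apply: le_trans (bnd_le a i); rewrite -normrN ler_norm.
by move=> r [n /(_ 0) rn]; exact: le_trans rn (nested_values_le _ _ _ as_).
Qed.

Lemma harmonic_fun_ge a r x : (forall i, r <= a i) -> r <= harmonic_fun a x.
Proof.
move=> ra; apply: sup_ubound; last by exists 0%N.
exists (bnd a) => s [n /(_ 0) sn]; apply: (le_trans sn); apply: nested_values_le => i.
exact: le_trans (ler_norm _) (bnd_le a i).
Qed.

Lemma harmonic_fun_glue a :
  harmonic_fun a = glue (fun i => harmonic_fun (corner_values a i)).
Proof.
apply/funext => x; rewrite /harmonic_fun /glue; congr sup; apply/seteqP; split => r.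
  by move=> [[|n] rn]; [exists 0%N => i; apply: corner_values_ge|exists n].
by move=> [n rn]; exists n.+1.
Qed.

(** The oscillation shrinks by 3/5 on every cell. *)
Lemma corner_values_osc a D i : (forall j k, `|a j - a k| <= D) ->
  forall j k, `|corner_values a i j - corner_values a i k| <= D * (3 / 5).
Proof.
move=> aD j k.
have h j' k' : (a j' - a k' <= D)%R.
  by apply: le_trans (aD j' k'); rewrite ler_norm.
rewrite ler_norml /corner_values.
move: (h 0 1) (h 0 2) (h 1 2) (h 1 0) (h 2 0) (h 2 1).
by elim/ord3_ind: i; elim/ord3_ind: j; elim/ord3_ind: k => /=;
  move=> ? ? ? ? ? ?; apply/andP; split; lra.
Qed.

Lemma harmonic_fun_osc a D x j :
  (forall j k, `|a j - a k| <= D) -> `|harmonic_fun a x - a j| <= D.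
Proof.
move=> aD; rewrite ler_distl; apply/andP; split.
  apply: harmonic_fun_ge => i; rewrite lerBlDr -lerBlDl.
  exact: le_trans (ler_norm _) (aD j i).
apply: harmonic_fun_le => i; rewrite -lerBlDl.
exact: le_trans (ler_norm _) (aD i j).
Qed.

Lemma geometric_lt (D e : R) : 0 < e -> exists n, D * (3 / 5) ^+ n < e.
Proof.
move=> e0; have h : D * (3 / 5) ^+ n @[n --> \oo] --> (0 : R).
  rewrite -(mulr0 D); apply: cvgMr; apply: cvg_expr.
  by rewrite ger0_norm ?divr_ge0//; lra.
have /cvgrPdist_lt /(_ e e0)[N _ /(_ N (leqnn _))] := h.
by rewrite sub0r normrN => /(le_lt_trans (ler_norm _)) ?; exists N.
Qed.

Lemma geometric_eq0 (D t : R) : (forall n, `|t| <= D * (3 / 5) ^+ n) -> t = 0.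
Proof.
move=> tD; apply/eqP; rewrite -normr_eq0 eq_le normr_ge0 andbT leNgt.
by apply/negP => /(geometric_lt D)[n]; rewrite ltNge tD.
Qed.

Lemma cell_p j : cell (p j) = j.
Proof.
have := cellP j (@triangle_p R j); rewrite gasket_Fp => -[//|[cj]].
by move=> /gasket_p_inj; exact: esym.
Qed.

Lemma osc_bnd (a : 'I_3 -> R) : exists D, forall j k, `|a j - a k| <= D.
Proof.
exists (bnd a + bnd a) => j k.
by apply: (le_trans (ler_normB _ _)); rewrite lerD.
Qed.

Lemma harmonic_fun_p a j : harmonic_fun a (p j) = a j.
Proof.
have [D aD] := osc_bnd a.
apply/eqP; rewrite -subr_eq0; apply/eqP; apply: (@geometric_eq0 D) => n.
elim: n a D aD => [|n IH] a D aD.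
  by rewrite mulr1; exact: harmonic_fun_osc.
rewrite harmonic_fun_glue /glue cell_p -(gasket_Fp _ j) gasket_FK.
have := IH _ _ (corner_values_osc j aD).
have -> : corner_values a j j = a j by rewrite /corner_values eqxx.
by rewrite -mulrA -exprS.
Qed.

Lemma harmonic_fun_F a i y : triangle y ->
  harmonic_fun a (F i y) = harmonic_fun (corner_values a i) y.
Proof.
move=> Ty; rewrite harmonic_fun_glue glueE// => j k.
by rewrite !harmonic_fun_p corner_valuesC.
Qed.

Lemma graph_energy_harmonic_fun n a :
  graph_energy n (harmonic_fun a) = triangle_energy a.
Proof.
elim: n a => [|n IH] a.
  by rewrite graph_energy0; congr triangle_energy; apply/funext => i /=; rewrite harmonic_fun_p.
rewrite graph_energyS.
have h i : graph_energy n (harmonic_fun a \o F i) = triangle_energy (corner_values a i).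
  rewrite -IH; apply: eq_graph_energy => x /gasket_V_triangle Tx.
  exact: harmonic_fun_F.
rewrite sum_ord3 !h /triangle_energy /corner_values /=; by field.
Qed.

(** The extension of [U] from [gasket_V R n] that is harmonic in every cell of
    level [n]. *)
Fixpoint cellwise_harmonic (n : nat) (U : plane R -> R) : plane R -> R :=
  if n is n'.+1 then glue (fun i => cellwise_harmonic n' (U \o F i))
  else harmonic_fun (U \o p).

Lemma cellwise_harmonic_V n U x : V n x -> cellwise_harmonic n U x = U x.
Proof.
elim: n U x => [|n IH] U x.
  by move=> /gasket_V0[i ->]; rewrite /= harmonic_fun_p.
move=> /gasket_VS[i [y Vy ->]] /=; rewrite glueE.
- by rewrite IH.
- move=> j k; rewrite !IH; try exact: gasket_V_p.
  exact: (congr1 U (gasket_FpC _ _ _)).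
- exact: gasket_V_triangle Vy.
Qed.

Lemma cellwise_harmonic_F n U i y : triangle y ->
  cellwise_harmonic n.+1 U (F i y) = cellwise_harmonic n (U \o F i) y.
Proof.
move=> Ty; rewrite /= glueE// => j k.
rewrite !cellwise_harmonic_V; try exact: gasket_V_p.
exact: (congr1 U (gasket_FpC _ _ _)).
Qed.

Lemma graph_energy_cellwise_harmonic n k U : (n <= k)%N ->
  graph_energy k (cellwise_harmonic n U) = graph_energy n U.
Proof.
elim: n k U => [|n IH] k U.
  by move=> _; rewrite graph_energy_harmonic_fun graph_energy0.
case: k => // k nk; rewrite !graph_energyS; congr (_ * _).
apply: eq_bigr => i _; rewrite -(IH k)//; apply: eq_graph_energy => x.
move=> /gasket_V_triangle Tx /=.
by rewrite -[LHS]/(cellwise_harmonic n.+1 U (F i x)) cellwise_harmonic_F.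
Qed.

End HarmonicFunctions.

(** * Continuity on the gasket *)

Section Gasket.
Variables (R : realType) (K : set (plane R)).
Hypothesis gK : is_gasket K.
Local Notation p := (@gasket_p R).
Local Notation F := (@gasket_F R).
Local Notation G := (@gasket_G R).
Local Notation V := (gasket_V R).

Lemma affine_continuous (c : R) (a b : plane R) :
  continuous (fun z : plane R => c *: (z - a) + b).
Proof.
move=> z; apply: cvgD; last exact: cvg_cst.
by apply: cvgZr; apply: cvgB; [exact: cvg_id|exact: cvg_cst].
Qed.

Lemma gasket_KF i x : K x -> K (F i x).
Proof. by have [_ _ KE] := gK; move=> Kx; rewrite KE; exists i => //; exists x. Qed.

Lemma gasket_KP x : K x -> exists i, (F i @` K) x.
Proof. by have [_ _ KE] := gK; rewrite {1}KE => -[i _ Kx]; exists i. Qed.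

Lemma gasket_K_closed : closed K.
Proof. by have [_ Kc _] := gK; apply: compact_closed => //; exact: norm_hausdorff. Qed.

Lemma gasket_KF_closed i : closed (F i @` K).
Proof.
have [_ Kc _] := gK; apply: compact_closed; first exact: norm_hausdorff.
apply: continuous_compact => //; apply: continuous_subspaceT => z.
exact: affine_continuous.
Qed.

(** A compact set with [K = \bigcup_i F i @` K] lies in the triangle: as [K]
    consists of its images under the [F i], a negative lower bound of a barycentric
    coordinate on [K] can be halved indefinitely. *)
Lemma gasket_K_triangle : K `<=` @triangle R.
Proof.
have [_ Kc _] := gK.
have [M [_ /(_ (`|M| + 1))]] := compact_bounded Kc.
rewrite (le_lt_trans (ler_norm M)) ?ltrDl// => /(_ isT) KM.
set N := `|M| + 1 in KM.
have N0 : 0 <= N by rewrite addr_ge0.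
pose B := 1 + N + 2 * (N / Num.sqrt 3).
have s3 : 0 <= (Num.sqrt 3)^-1 :> R by rewrite invr_ge0 sqrtr_ge0.
have KB i x : K x -> - B <= bary i x.
  move=> /KM /=; rewrite prod_normE ge_max => /andP[].
  rewrite !ler_norml => /andP[x1 x1'] /andP[x2 x2'].
  have := ler_wpM2r s3 x2; have := ler_wpM2r s3 x2'.
  rewrite mulNr => h1 h2.
  by rewrite /B; elim/ord3_ind: i; rewrite /bary /=; lra.
have B0 : 0 <= B by rewrite /B !addr_ge0// !mulr_ge0.
(* The ratio is 1/2; any larger ratio below 1 would do. *)
have KBn n i x : K x -> - bary i x <= B * (3 / 5) ^+ n.
  elim: n x => [|n IH] x; first by move=> /(KB i); rewrite mulr1; lra.
  move=> /gasket_KP[j [y Ky <-]]; rewrite bary_F exprS.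
  have : 0 <= B * (3 / 5) ^+ n by rewrite mulr_ge0// exprn_ge0// divr_ge0.
  have := IH y Ky; have := ler0n R (i == j).
  lra.
move=> x Kx i; rewrite leNgt; apply/negP => xi.
have := @geometric_lt _ B (- bary i x); rewrite oppr_gt0 => /(_ xi)[n].
by rewrite ltNge KBn.
Qed.

Lemma gasket_K_p i : K (p i).
Proof.
have [[y Ky] _ _] := gK.
have Kn n : K ((2^-1) ^+ n *: (y - p i) + p i).
  elim: n => [|n IH]; first by rewrite scale1r subrK.
  have -> : (2^-1) ^+ n.+1 *: (y - p i) + p i = F i ((2^-1) ^+ n *: (y - p i) + p i).
    by rewrite /gasket_F addrK scalerA exprS.
  exact: gasket_KF.
apply: (@closed_cvg _ _ \oo _ (fun n => (2^-1) ^+ n *: (y - p i) + p i) K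
  gasket_K_closed _ (p i)); first exact: nearW.
rewrite -[X in _ --> X]add0r; apply: cvgD; last exact: cvg_cst.
rewrite -(scale0r (y - p i)); apply: cvgZr_tmp; apply: cvg_expr.
by rewrite ger0_norm ?invr_ge0//; lra.
Qed.

Lemma gasket_V_K n : V n `<=` K.
Proof.
elim: n => [|n IH] x; first by move=> /gasket_V0[i ->]; exact: gasket_K_p.
by move=> /gasket_VS[i [y /IH Ky ->]]; exact: gasket_KF.
Qed.

(** Continuity on [K] up to an error [e]. *)
Definition almost_continuous (e : R) (f : plane R -> R) :=
  forall x, K x -> \forall y \near x, K y -> `|f x - f y| <= e.

(** Near [x], only the cells containing [x] matter, as the other ones are closed. *)
Lemma almost_continuous_glue e (g : 'I_3 -> plane R -> R) :
  (forall i j, g i (p j) = g j (p i)) ->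
  (forall i, almost_continuous e (g i)) -> almost_continuous e (glue g).
Proof.
move=> gC ge x Kx.
have H i : \forall y \near x, (F i @` K) y -> `|glue g x - glue g y| <= e.
  have [[x' Kx' <-]|nx] := pselect ((F i @` K) x).
    have GF : G i z @[z --> F i x'] --> G i (F i x') by exact: affine_continuous.
    rewrite gasket_FK in GF.
    have nG : \forall y \near F i x', K (G i y) -> `|g i x' - g i (G i y)| <= e.
      exact: (GF _ (ge i x' Kx')).
    apply: filterS nG => y + [y' Ky' yE].
    rewrite -yE gasket_FK => /(_ Ky').
    by rewrite !glueE//; exact: gasket_K_triangle.
  have FC : nbhs x (~` (F i @` K)).
    by apply: open_nbhs_nbhs; split => //; exact/closed_openC/gasket_KF_closed.
  by apply: filterS FC => y ny /ny.
have HA : \forall y \near x, forall i, (F i @` K) y -> `|glue g x - glue g y| <= e.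
  exact: (@filter_forall _ _
    (fun i y => (F i @` K) y -> `|glue g x - glue g y| <= e) _ _ H).
apply: filterS HA => y Hy Ky.
by have [i Fy] := gasket_KP Ky; exact: Hy i Fy.
Qed.

Lemma almost_continuous_harmonic_fun n a D : (forall j k, `|a j - a k| <= D) ->
  almost_continuous (D * (3 / 5) ^+ n) (harmonic_fun a).
Proof.
elim: n a D => [|n IH] a D aD.
  move=> x Kx; apply: filterS filterT => y _ Ky; rewrite mulr1.
  have h u v : harmonic_fun a u <= harmonic_fun a v + D.
    apply: harmonic_fun_le => i; have := harmonic_fun_osc v i aD.
    by rewrite ler_norml => /andP[+ _]; lra.
  by rewrite ler_norml; have := h x y; have := h y x => ? ?; apply/andP; split; lra.
rewrite harmonic_fun_glue; apply: almost_continuous_glue => [i j|i].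
  by rewrite !harmonic_fun_p corner_valuesC.
by rewrite exprS mulrA; apply: IH; exact: corner_values_osc.
Qed.

Lemma almost_continuous_cellwise_harmonic n U e : 0 < e ->
  almost_continuous e (cellwise_harmonic n U).
Proof.
move=> e0; elim: n U => [|n IH] U; last first.
  rewrite -[cellwise_harmonic n.+1 U]/(glue (fun i => cellwise_harmonic n (U \o F i))).
  apply: almost_continuous_glue => [i j|i]; last exact: IH.
  rewrite !cellwise_harmonic_V; try exact: gasket_V_p.
  exact: (congr1 U (gasket_FpC _ _ _)).
have [D UD] := osc_bnd (U \o p).
have [k De] := geometric_lt D e0.
move=> x Kx; apply: filterS (almost_continuous_harmonic_fun k UD Kx) => y h /h ?.
apply: le_trans (ltW De); exact.
Qed.

Lemma cellwise_harmonic_continuous n U :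
  continuous (sigL K (cellwise_harmonic n U)).
Proof.
apply/subspace_sigL_continuousP/subspace_continuousP => x Kx.
apply/cvgrPdist_le => e e0; exact: almost_continuous_cellwise_harmonic e0 _ Kx.
Qed.

(** Functions on a vertex set extend to [K] without change of energy. *)
Lemma cellwise_harmonic_std_dom n U :
  @std_dom R K (sigL K (cellwise_harmonic n U)) /\
  @std_form R K (sigL K (cellwise_harmonic n U)) = graph_energy n U.
Proof.
have h : gasket_energy (restr (V m) (sigL K (cellwise_harmonic n U))) @[m --> \oo]
    --> graph_energy n U.
  apply: cvg_near_cst; exists n => // m /= nm.
  rewrite gasket_energyE -(graph_energy_cellwise_harmonic U nm).
  apply: eq_graph_energy => x Vx.
  by rewrite restr_sigL_sub ?valL_sigL//; exact: gasket_V_K.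
split; last exact/cvg_lim.
split; first exact: cellwise_harmonic_continuous.
by apply/cvg_ex; exists (graph_energy n U).
Qed.

End Gasket.

(** * Scaled gaskets closed by a resistor *)

Section ScaledGaskets.
Variable R : realType.
Local Notation p := (@gasket_p R).
Local Notation F := (@gasket_F R).
Local Notation V := (gasket_V R).
Local Notation rho := (@gasket_rho R).

Lemma seq_VP m x : seq_V R m x <-> exists2 y, V (m + m) y & x = rho m y.
Proof. by split=> [[y Vy <-]|[y Vy ->]]; exists y. Qed.

Lemma seq_V_rho m y : V (m + m) y -> seq_V R m (rho m y).
Proof. by move=> Vy; apply/seq_VP; exists y. Qed.

(** The inverse of [gasket_rho m]. *)
Definition gasket_rhoV (m : nat) (z : plane R) : plane R := (2 ^+ m)^-1 *: z.

Lemma gasket_rhoK m : cancel (rho m) (gasket_rhoV m).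
Proof.
move=> z; rewrite /gasket_rho /gasket_rhoV scalerA mulVf ?scale1r//.
Qed.

Lemma gasket_rho_F0 m z : rho m.+1 (F 0 z) = rho m z.
Proof.
rewrite /gasket_rho /gasket_F (_ : p 0 = 0)// subr0 addr0 scalerA exprSr.
by rewrite -mulrA divff ?mulr1.
Qed.

Lemma seq_V_nest m : seq_V R m `<=` seq_V R m.+1.
Proof.
move=> x /seq_VP[y Vy ->]; rewrite -gasket_rho_F0; apply: seq_V_rho.
rewrite addnS addSn; apply/gasket_VS; exists 0; exists y => //.
exact: gasket_V_nest.
Qed.

Lemma seq_V_finite m : finite_set (seq_V R m).
Proof. by apply: finite_image; exact: gasket_V_finite. Qed.

Lemma seq_V_p m i : seq_V R m (rho m (p i)).
Proof. by apply: seq_V_rho; exact: gasket_V_p. Qed.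

(** [seq_Q] for functions on the whole plane: the scaled gasket, closed by a
    resistor between its two outer corners. *)
Definition closed_energy (m : nat) (U : plane R -> R) : R :=
  (3 / 5) ^+ m * graph_energy (m + m) (U \o rho m) +
  5 / 6 * (3 / 5) ^+ m * (U (rho m (p 1)) - U (rho m (p 2))) ^+ 2.

Lemma seq_Q_sigL m U : seq_Q (sigL (seq_V R m) U) = closed_energy m U.
Proof.
have UE x : V (m + m) x -> 'valL_ 0 (sigL (seq_V R m) U) (rho m x) = U (rho m x).
  by move=> Vx; rewrite valL_sigL//; exact: seq_V_rho.
rewrite /seq_Q /closed_energy /scaled_p !UE; try exact: gasket_V_p.
congr (_ * _ + _); rewrite gasket_energyE.
by apply: eq_graph_energy => x Vx; rewrite valL_sigL//=; exact: UE.
Qed.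

Lemma energy_closed_energy m : energy (closed_energy m).
Proof.
have c0 : 0 <= (3 / 5) ^+ m :> R by rewrite exprn_ge0// divr_ge0.
apply: energyD; first by apply/energyM => //; apply/energy_comp/graph_energy_energy.
by apply: energyM; [rewrite mulr_ge0|exact: energy_edge].
Qed.

(** [phi] is a retraction onto [seq_V R m]; composing with it makes [seq_Q] an
    instance of [closed_energy]. *)
Lemma seq_Q_comp m : exists2 phi : plane R -> seq_V R m,
  (forall x : seq_V R m, phi (\val x) = x) &
  forall u : seq_V R m -> R, seq_Q u = closed_energy m (u \o phi).
Proof.
pose a : seq_V R m := SigSub (mem_set (@seq_V_p m 0)).
pose phi (x : plane R) : seq_V R m := insubd a x.
have phiK x : phi (\val x) = x by exact: valKd.
exists phi => // u.
rewrite -seq_Q_sigL; congr seq_Q; apply/funext => x /=.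
by congr u; exact: esym (phiK x).
Qed.

Lemma energy_seq_Q m : energy (@seq_Q R m).
Proof.
have [phi _ phiE] := seq_Q_comp m.
have -> : @seq_Q R m = fun u => closed_energy m (u \o phi).
  by apply/funext => u.
exact/energy_comp/energy_closed_energy.
Qed.

Lemma graph_energy_le_closed_energy m U :
  graph_energy (m + m) (U \o rho m) <= (5 / 3) ^+ m * closed_energy m U.
Proof.
have h : (5 / 3) ^+ m * (3 / 5) ^+ m = 1 :> R.
  by rewrite -exprMn (_ : 5 / 3 * (3 / 5) = 1) ?expr1n//; field.
rewrite /closed_energy mulrDr mulrA h mul1r lerDl.
apply: mulr_ge0; first by rewrite exprn_ge0// divr_ge0.
by rewrite mulr_ge0 ?sqr_ge0// mulr_ge0 ?exprn_ge0 ?divr_ge0.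
Qed.

Lemma closed_energy_coercive m : exists C : R, forall U x y,
  seq_V R m x -> seq_V R m y -> (U x - U y) ^+ 2 <= C * closed_energy m U.
Proof.
have [C C0 CE] := graph_energy_coercive R (m + m).
exists (C * (5 / 3) ^+ m) => U _ _ /seq_VP[x Vx ->] /seq_VP[y Vy ->].
apply: (le_trans (CE (U \o rho m) x y Vx Vy)).
by rewrite -mulrA ler_wpM2l// graph_energy_le_closed_energy.
Qed.

Lemma seq_Q_coercive m (x y : seq_V R m) : exists C : R, forall f,
  (f x - f y) ^+ 2 <= C * seq_Q f.
Proof.
have [C CE] := closed_energy_coercive m; exists C => f.
have [phi phiK ->] := seq_Q_comp m.
have := CE (f \o phi) _ _ (set_valP x) (set_valP y).
by rewrite /= !phiK.
Qed.

Lemma graph_energySS n U : graph_energy n.+2 U = 5 / 3 *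
  (graph_energy n.+1 (U \o F 0) + graph_energy n.+1 (U \o F 1) +
   graph_energy n.+1 (U \o F 2)).
Proof. by rewrite graph_energyS sum_ord3. Qed.

(** The form of index [m.+1], seen on the three cells of the gasket; the first cell
    carries the points of [seq_V R m], by [gasket_rho_F0].  The coefficient of the
    resistor is [5 / 6 * (3 / 5) = 2^-1] in units of [(3 / 5) ^+ m]. *)
Lemma closed_energyS m U : let w := U \o rho m.+1 in
  closed_energy m.+1 U = (3 / 5) ^+ m *
  (graph_energy (m + m).+1 (w \o F 0) + graph_energy (m + m).+1 (w \o F 1) +
   graph_energy (m + m).+1 (w \o F 2) + 2^-1 * (w (p 1) - w (p 2)) ^+ 2).
Proof.
move=> w; rewrite /closed_energy addnS addSn graph_energySS exprS /w /=.
by field.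
Qed.

Lemma closed_energyF m U : let w := U \o rho m.+1 in
  closed_energy m U = (3 / 5) ^+ m *
  (graph_energy (m + m) (w \o F 0) + 5 / 6 * (w (F 0 (p 1)) - w (F 0 (p 2))) ^+ 2).
Proof.
move=> w; rewrite /closed_energy.
have -> : w \o F 0 = U \o rho m.
  by apply/funext => z; rewrite /w /comp gasket_rho_F0.
rewrite /w /comp !gasket_rho_F0; ring.
Qed.

(** The first cell, the two other cells reduced to triangles, and the resistor of
    weight [2^-1] form a network whose trace on the first cell is the gasket closed
    by the resistor of weight [5 / 6]. *)
Lemma closed_energy_mono m U : closed_energy m U <= closed_energy m.+1 U.
Proof.
rewrite closed_energyS closed_energyF; set w := U \o rho m.+1.
rewrite ler_wpM2l ?exprn_ge0 ?divr_ge0//.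
have h0 := graph_energy_mono (m + m) (w \o F 0).
have := graph_energy_le (w \o F 1) (leq0n (m + m).+1).
have := graph_energy_le (w \o F 2) (leq0n (m + m).+1).
rewrite !graph_energy0 /triangle_energy.
have -> : (w \o F 1) \o p = fun i => w (F 1 (p i)) by [].
have -> : (w \o F 2) \o p = fun i => w (F 2 (p i)) by [].
rewrite !gasket_Fp (gasket_FpC _ 1 0) (gasket_FpC _ 2 0) (gasket_FpC _ 2 1).
move: (w (F 0 (p 1))) (w (F 0 (p 2))) (w (p 1)) (w (p 2)) (w (F 1 (p 2))).
move=> a b x y z h1 h2.
(* Deviations from the minimizing potential. *)
pose d1 := x - (2 * a + b) / 3.
pose d2 := y - (a + 2 * b) / 3.
pose d3 := z - (a + b) / 2.
have := sqr_ge0 d1; have := sqr_ge0 d2; have := sqr_ge0 d3.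
have := sqr_ge0 (d1 - d2); have := sqr_ge0 (d1 - d3); have := sqr_ge0 (d2 - d3).
rewrite /d1 /d2 /d3; lra.
Qed.

Lemma closed_energy_ext m U : exists2 W,
  (forall x, seq_V R m x -> W x = U x) & closed_energy m.+1 W = closed_energy m U.
Proof.
set v := U \o rho m; set N := (m + m)%N.
pose a := v (p 1); pose b := v (p 2).
(* Corner values in the second and third cells: the two outer corners receive
   [(2 * a + b) / 3] and [(a + 2 * b) / 3], their midpoint [(a + b) / 2]. *)
pose c1 (i : 'I_3) := match val i with
  0%N => a | 1%N => (2 * a + b) / 3 | _ => (a + b) / 2 end.
pose c2 (i : 'I_3) := match val i with
  0%N => b | 1%N => (a + b) / 2 | _ => (a + 2 * b) / 3 end.
pose g (i : 'I_3) := match val i with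
  0%N => cellwise_harmonic N v | 1%N => harmonic_fun c1 | _ => harmonic_fun c2 end.
have gC i j : g i (p j) = g j (p i).
  have vp k : cellwise_harmonic N v (p k) = v (p k).
    by apply: cellwise_harmonic_V; exact: gasket_V_p.
  by elim/ord3_ind: i; elim/ord3_ind: j; rewrite /g /= ?harmonic_fun_p ?vp.
pose W := glue g \o gasket_rhoV m.+1.
have Wrho : W \o rho m.+1 = glue g.
  by apply/funext => z; rewrite /W /comp gasket_rhoK.
have gF k i : graph_energy k (glue g \o F i) = graph_energy k (g i).
  by apply: eq_graph_energy => x /gasket_V_triangle Tx; exact: glueE.
exists W.
  move=> _ /seq_VP[y Vy ->]; rewrite -{1}gasket_rho_F0.
  rewrite -[LHS]/((W \o rho m.+1) (F 0 y)) Wrho glueE//.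
    exact: cellwise_harmonic_V.
  exact: gasket_V_triangle Vy.
rewrite closed_energyS Wrho !gF.
rewrite -[g 0]/(cellwise_harmonic N v) -[g 1]/(harmonic_fun c1) -[g 2]/(harmonic_fun c2).
rewrite graph_energy_cellwise_harmonic ?leqnSn// !graph_energy_harmonic_fun.
rewrite -(gasket_Fp _ 1) -(gasket_Fp _ 2) !glueE//; try exact: triangle_p.
rewrite -[g 1]/(harmonic_fun c1) -[g 2]/(harmonic_fun c2) !harmonic_fun_p.
rewrite /closed_energy -/N -/v -[U (rho m (p 1))]/a -[U (rho m (p 2))]/b.
rewrite /triangle_energy /c1 /c2 /=; by field.
Qed.

End ScaledGaskets.

(** * Comparison of the resistance metrics *)

Section ResistanceBounds.
Variable R : realType.
Local Notation p := (@gasket_p R).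
Local Notation V := (gasket_V R).
Local Notation rho := (@gasket_rho R).
Local Notation Finf := (limit_dom (@seq_Q R)).
Local Notation Einf := (limit_form (@seq_Q R)).
Local Notation alpha := ((ln 5 - ln 3) / ln 2 : R).

Lemma alpha_neq0 : alpha != 0.
Proof.
by rewrite gt_eqF// divr_gt0 ?ln_gt0 ?ltr1n// subr_gt0 ltr_ln ?posrE// ltr_nat.
Qed.

Lemma two_powR_alpha : 2 `^ alpha = 5 / 3.
Proof.
rewrite /powR pnatr_eq0/= divfK; last by rewrite gt_eqF// ln_gt0// ltr1n.
by rewrite -ln_div ?posrE// lnK// posrE divr_gt0.
Qed.

Lemma eucl_dist_rho m (x y : plane R) :
  eucl_dist (rho m x) (rho m y) `^ alpha = (5 / 3) ^+ m * eucl_dist x y `^ alpha.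
Proof.
have -> : eucl_dist (rho m x) (rho m y) = 2 ^+ m * eucl_dist x y.
  rewrite /eucl_dist /gasket_rho /= /GRing.scale /= -!mulrBr !exprMn -mulrDr.
  by rewrite sqrtrM ?sqr_ge0// sqrtr_sqr ger0_norm// exprn_ge0.
rewrite powRM ?exprn_ge0 ?sqrtr_ge0//; congr (_ * _).
elim: m => [|m IH]; first by rewrite !expr0 powR1.
by rewrite !exprS powRM ?exprn_ge0// IH two_powR_alpha.
Qed.

Lemma seq_V_neq0 : seq_V R 0 !=set0.
Proof. by exists (rho 0 (p 0)); exact: seq_V_p. Qed.

Lemma seq_Q_mono m (U : plane R -> R) :
  seq_Q (sigL (seq_V R m) U) <= seq_Q (sigL (seq_V R m.+1) U).
Proof. by rewrite !seq_Q_sigL closed_energy_mono. Qed.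

Lemma seq_Q_ext m (U : plane R -> R) : exists2 W : plane R -> R,
  (forall x, seq_V R m x -> W x = U x) &
  seq_Q (sigL (seq_V R m.+1) W) = seq_Q (sigL (seq_V R m) U).
Proof.
have [W WU WE] := closed_energy_ext m U; exists W => //.
by rewrite !seq_Q_sigL.
Qed.

(** Two points of the union lie in [seq_V R m] for arbitrarily large [m]. *)
Lemma seq_V_common (x y : \bigcup_m seq_V R m) n : exists2 m, (n <= m)%N &
  exists x' y', [/\ V (m + m) x', V (m + m) y',
    \val x = rho m x' & \val y = rho m y'].
Proof.
have [i _ Vi] := set_valP x; have [j _ Vj] := set_valP y.
pose m := maxn n (maxn i j).
have /seq_VP[x' Vx xE] : seq_V R m (\val x).
  by apply: (nested_subset (@seq_V_nest R)) Vi; rewrite /m !leq_max leqnn !orbT.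
have /seq_VP[y' Vy yE] : seq_V R m (\val y).
  by apply: (nested_subset (@seq_V_nest R)) Vj; rewrite /m !leq_max leqnn !orbT.
by exists m; [exact: leq_maxl|exists x', y'].
Qed.

Lemma limit_closed_extension m (U : plane R -> R) : exists2 W : plane R -> R,
  (forall x, seq_V R m x -> W x = U x) &
  Finf (sigL (\bigcup_m seq_V R m) W) /\
  Einf (sigL (\bigcup_m seq_V R m) W) = closed_energy m U.
Proof.
rewrite -seq_Q_sigL.
exact: (limit_extension (@seq_V_nest R) seq_Q_ext).
Qed.

Lemma Einf_resistance_form : resistance_form Finf Einf.
Proof.
exact: (limit_form_resistance_form seq_V_neq0 (@seq_V_nest R) (@energy_seq_Q R)
  (@seq_Q_coercive R) seq_Q_mono seq_Q_ext).
Qed.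

Lemma closed_energy_le_Einf m (f : \bigcup_m seq_V R m -> R) : Finf f ->
  closed_energy m ('valL_ 0 f) <= Einf f.
Proof.
rewrite -seq_Q_sigL => Ff; exact: (limit_form_ge seq_Q_mono m Ff).
Qed.

Lemma clip_bound (T : Type) (f : T -> R) x : 0 <= clip f x <= 1.
Proof.
by rewrite /clip le_min ge_min lexx orbT le_max lexx !orbT ler01.
Qed.

Variables (K : set (plane R)) (c1 c2 : R).
Hypotheses (gK : is_gasket K) (c2_gt0 : 0 < c2).
Hypothesis RK : forall x y : K,
  ((c1 * eucl_dist (\val x) (\val y) `^ alpha)%:E
     <= resistance_metric (@std_dom R K) (@std_form R K) x y
     <= (c2 * eucl_dist (\val x) (\val y) `^ alpha)%:E)%E.

Lemma graph_energy_le_std_form m (f : K -> R) : std_dom f ->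
  graph_energy m ('valL_ 0 f) <= std_form f.
Proof.
move=> [_ cf].
have h k : gasket_energy (restr (V k) f) = graph_energy k ('valL_ 0 f).
  rewrite gasket_energyE; apply: eq_graph_energy => x Vx.
  by rewrite -{1}(valLK (0 : R) f) restr_sigL_sub ?valL_sigL//; exact: gasket_V_K.
rewrite -h; apply: nondecreasing_cvgn_le => //.
by apply/nondecreasing_seqP => k; rewrite !h graph_energy_mono.
Qed.

(** The upper bound of the standard resistance metric holds on the finite graphs. *)
Lemma vertex_resistance_le n (v : plane R -> R) x y : V n x -> V n y ->
  (v x - v y) ^+ 2 <= c2 * eucl_dist x y `^ alpha * graph_energy n v.
Proof.
move=> Vx Vy.
have [v0|v0] := eqVneq (graph_energy n v) 0.
  have [C _ /(_ v x y Vx Vy)] := graph_energy_coercive R n.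
  by rewrite v0 !mulr0.
have [fd fE] := cellwise_harmonic_std_dom gK n v.
pose kx : K := SigSub (mem_set (gasket_V_K gK Vx)).
pose ky : K := SigSub (mem_set (gasket_V_K gK Vy)).
have [] := andP (RK kx ky) => _; apply: contraTT; rewrite -!ltNge => h.
apply: lt_le_trans (resistance_metric_ge kx ky fd _); rewrite fE//.
rewrite lte_fin ltr_pdivlMr; last first.
  by rewrite lt_neqAle eq_sym v0 (energy_ge0 (graph_energy_energy _ _)).
by rewrite /sigL /= !cellwise_harmonic_V.
Qed.

Lemma Einf_resistance_le (x y : \bigcup_m seq_V R m) :
  (resistance_metric Finf Einf x y <=
   (c2 * eucl_dist (\val x) (\val y) `^ alpha)%:E)%E.
Proof.
have [m _ [x' [y' [Vx Vy xE yE]]]] := seq_V_common x y 0.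
apply: resistance_metric_le; first exact: (RF1_ge0 Einf_resistance_form).
move=> f Ff; set U := 'valL_ 0 f.
have UE (z : \bigcup_m seq_V R m) : f z = U (\val z).
  by rewrite /U -[in LHS](valLK (0 : R) f).
rewrite !UE xE yE eucl_dist_rho.
apply: (le_trans (vertex_resistance_le (U \o rho m) Vx Vy)).
have c2d : 0 <= c2 * eucl_dist x' y' `^ alpha by rewrite mulr_ge0 ?powR_ge0 ?ltW.
have -> : c2 * ((5 / 3) ^+ m * eucl_dist x' y' `^ alpha) * Einf f =
  c2 * eucl_dist x' y' `^ alpha * ((5 / 3) ^+ m * Einf f) by ring.
rewrite ler_wpM2l//; apply: (le_trans (graph_energy_le_closed_energy m U)).
by rewrite ler_wpM2l ?exprn_ge0 ?divr_ge0// closed_energy_le_Einf.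
Qed.

(** A potential with values in [0, 1] whose energy is at most the inverse of any
    given number below the lower bound of the resistance. *)
Lemma vertex_resistance_ge n x y (t : R) : V n x -> V n y ->
  0 < t < c1 * eucl_dist x y `^ alpha ->
  exists v : plane R -> R, [/\ v x = 1, v y = 0, forall z, 0 <= v z <= 1 &
    graph_energy n v <= t^-1].
Proof.
move=> Vx Vy /andP[t0 tlt].
pose kx : K := SigSub (mem_set (gasket_V_K gK Vx)).
pose ky : K := SigSub (mem_set (gasket_V_K gK Vy)).
have [Rl _] := andP (RK kx ky).
have : (t%:E < resistance_metric (@std_dom R K) (@std_form R K) kx ky)%E.
  by apply: lt_le_trans Rl; rewrite lte_fin.
move=> /ereal_sup_gt[_ [f [fd fE0 ->]]]; rewrite lte_fin.
rewrite real_normK ?num_real// => tf.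
set w := 'valL_ 0 f.
have wE (z : K) : f z = w (\val z) by rewrite /w -[in LHS](valLK (0 : R) f).
have en := graph_energy_energy R n.
have we : graph_energy n w <= std_form f by exact: graph_energy_le_std_form.
have fE : 0 < std_form f.
  by rewrite lt_neqAle eq_sym fE0 (le_trans _ we)// energy_ge0.
move: tf; rewrite !wE -[\val kx]/x -[\val ky]/y ltr_pdivlMr// => tf.
pose d := w x - w y.
have d0 : d != 0.
  by apply: contraTneq tf; rewrite -/d => ->; rewrite expr0n/= -leNgt mulr_ge0 ?ltW.
(* The test function, made affinely equal to 1 at [x] and 0 at [y], then clipped;
   neither step increases the ratio of the energy to the squared difference of the
   values at [x] and [y]. *)
pose h := clip (d^-1 *: (fun z => w z + - w y)).
have hx : (d^-1 *: (fun z => w z + - w y)) x = 1 by exact: mulVf.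
have hy : (d^-1 *: (fun z => w z + - w y)) y = 0.
  by rewrite !fctE subrr scaler0.
exists h; split.
- by rewrite /h /clip hx maxEle ler10 minxx.
- by rewrite /h /clip hy maxxx minEle ler01.
- by move=> z; exact: clip_bound.
- apply: (le_trans (energy_clip en _)); rewrite (energyZ en) (energyDc en).
  rewrite exprVn mulrC ler_pdivrMr ?exprn_even_gt0//.
  rewrite ler_pdivlMl//; apply: ltW; apply: le_lt_trans tf.
  by rewrite ler_wpM2l// ltW.
Qed.

(** A test function for the scaled gasket of index [m] with values in [0, 1] has at
    most the additional energy [5 / 6 * (3 / 5) ^+ m], which is negligible for
    large [m]. *)
Lemma Einf_resistance_ge_approx (x y : \bigcup_m seq_V R m) (s : R) :
  0 < s < c1 * eucl_dist (\val x) (\val y) `^ alpha ->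
  (s%:E <= resistance_metric Finf Einf x y)%E.
Proof.
set r := c1 * _ => /andP[s0 sr].
(* The gap between [t] and [s] leaves room for the additional energy. *)
pose t := (s + r) / 2.
have st : s < t by rewrite /t; lra.
have tr : t < r by rewrite /t; lra.
have t0 : 0 < t by exact: lt_trans st.
have [n nP] : exists n, 5 / 6 * (3 / 5) ^+ n < s^-1 - t^-1.
  by apply: geometric_lt; rewrite subr_gt0 ltf_pV2.
have [m nm [x' [y' [Vx Vy xE yE]]]] := seq_V_common x y n.
have c53 : (5 / 3) ^+ m * (3 / 5) ^+ m = 1 :> R.
  by rewrite -exprMn (_ : 5 / 3 * (3 / 5) = 1) ?expr1n//; field.
have c35 : 0 < (3 / 5) ^+ m :> R by rewrite exprn_gt0// divr_gt0.
set q := (3 / 5) ^+ m in c53 c35.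
have rE : q * r = c1 * eucl_dist x' y' `^ alpha.
  by rewrite /r xE yE eucl_dist_rho mulrCA (mulrA q) (mulrC q) c53 mul1r.
have qt : 0 < q * t < c1 * eucl_dist x' y' `^ alpha.
  by rewrite -rE mulr_gt0//= ltr_pM2l.
have [v [vx vy v01 ve]] := vertex_resistance_ge Vx Vy qt.
pose U := v \o gasket_rhoV m.
have UE : U \o rho m = v by apply/funext => z; rewrite /U /comp gasket_rhoK.
have Urho z : U (rho m z) = v z by rewrite -[RHS](congr1 (@^~ z) UE).
have [W WU [FW EW]] := limit_closed_extension m U.
have Wx : W (\val x) = 1 by rewrite xE WU ?Urho//; exact: seq_V_rho.
have Wy : W (\val y) = 0 by rewrite yE WU ?Urho//; exact: seq_V_rho.
have Es : closed_energy m U <= s^-1.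
  rewrite /closed_energy UE -/q !Urho.
  have h1 : q * graph_energy (m + m) v <= t^-1.
    by rewrite -ler_pdivlMl// -invfM.
  have h2 : (v (p 1) - v (p 2)) ^+ 2 <= 1.
    have := v01 (p 1); have := v01 (p 2); nra.
  have h3 : q <= (3 / 5) ^+ n by rewrite ler_wiXn2l ?divr_ge0//; lra.
  have h4 : 5 / 6 * q * (v (p 1) - v (p 2)) ^+ 2 <= 5 / 6 * (3 / 5) ^+ n.
    rewrite -mulrA ler_wpM2l ?divr_ge0//; apply: le_trans h3.
    by rewrite ler_piMr// ltW.
  have := lerD h1 h4; lra.
have E0 : 0 < closed_energy m U.
  rewrite lt_neqAle energy_ge0 ?andbT; last exact: energy_closed_energy.
  apply/eqP => E0; have [C CE] := closed_energy_coercive R m.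
  have := CE U _ _ (seq_V_rho Vx) (seq_V_rho Vy).
  by rewrite -E0 mulr0 !Urho vx vy subr0 expr1n ler10.
have Ene : Einf (sigL (\bigcup_m seq_V R m) W) != 0 by rewrite EW gt_eqF.
apply: le_trans (resistance_metric_ge x y FW Ene).
rewrite EW /sigL /= -[set_val x]/(\val x) -[set_val y]/(\val y) Wx Wy.
by rewrite subr0 expr1n div1r lee_fin -[s]invrK lef_pV2 ?posrE ?invr_gt0.
Qed.

Lemma resistance_metric_ge0 (x y : \bigcup_m seq_V R m) :
  (0 <= resistance_metric Finf Einf x y)%E.
Proof.
have [a [b ab]] : exists a b : \bigcup_m seq_V R m, a <> b.
  have h i : (\bigcup_m seq_V R m) (rho 0 (p i)) by exists 0%N => //; exact: seq_V_p.
  exists (SigSub (mem_set (h 0))), (SigSub (mem_set (h 1))).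
  by move=> /(congr1 val) /= /(can_inj (@gasket_rhoK R 0%N)) /gasket_p_inj.
have [f Ff fab] := RF3 Einf_resistance_form ab.
have Ef : Einf f != 0.
  apply/eqP => /(RF1_eq0 Einf_resistance_form Ff)[c fc].
  by apply: fab; rewrite fc.
apply: le_trans (resistance_metric_ge x y Ff Ef).
rewrite lee_fin divr_ge0 ?sqr_ge0//; exact: (RF1_ge0 Einf_resistance_form Ff).
Qed.

Lemma Einf_resistance_ge (x y : \bigcup_m seq_V R m) :
  ((c1 * eucl_dist (\val x) (\val y) `^ alpha)%:E <=
   resistance_metric Finf Einf x y)%E.
Proof.
have R0 := resistance_metric_ge0 x y.
have [->|xy] := pselect (x = y).
  rewrite (_ : eucl_dist _ _ = 0); last first.
    by rewrite /eucl_dist !subrr expr0n addr0 sqrtr0.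
  by rewrite powR0 ?mulr0 ?alpha_neq0//; exact: resistance_metric_ge0.
rewrite leNgt; apply/negP => Rlt.
move: (@Einf_resistance_ge_approx x y) R0 Rlt.
case: (resistance_metric _ _ _ _) => [r| |] //= h; rewrite lee_fin lte_fin => r0.
set d := c1 * _ in h * => rd.
have /h : 0 < (r + d) / 2 < d by apply/andP; split; lra.
by rewrite lee_fin; lra.
Qed.

End ResistanceBounds.

Theorem theorem3p3 (R : realType) :
  let Einf := limit_form (@seq_Q R) in
  let Finf := limit_dom (@seq_Q R) in
  let alpha : R := (ln 5 - ln 3) / ln 2 in
  [/\ finite_resistance_forms (@seq_Q R),
      compatible (@seq_Q R),
      resistance_form Finf Einf &
      forall (K : set (plane R)) (c1 c2 : R),
        is_gasket K -> 0 < c1 -> 0 < c2 ->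
        (forall x y : K,
           ((c1 * eucl_dist (\val x) (\val y) `^ alpha)%:E
              <= resistance_metric (@std_dom R K) (@std_form R K) x y
              <= (c2 * eucl_dist (\val x) (\val y) `^ alpha)%:E)%E) ->
        forall x y : \bigcup_m seq_V R m,
          ((c1 * eucl_dist (\val x) (\val y) `^ alpha)%:E
             <= resistance_metric Finf Einf x y
             <= (c2 * eucl_dist (\val x) (\val y) `^ alpha)%:E)%E].
Proof.
move=> Einf Finf alpha; split.
- exact: (finite_resistance_forms_ext (seq_V_neq0 R) (@seq_V_nest R)
    (@energy_seq_Q R) (@seq_Q_coercive R) (@seq_V_finite R)).
- exact: (compatible_ext (@seq_V_nest R) (@seq_Q_mono R) (@seq_Q_ext R)).
- exact: Einf_resistance_form.
- move=> K c1 c2 gK c1_gt0 c2_gt0 RK x y; apply/andP; split.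
    exact: (Einf_resistance_ge gK RK).
  exact: (Einf_resistance_le gK c2_gt0 RK).
Qed.
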